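(* Let $K$ be a field, $S=K[x_1,\ldots,x_n]$, and let $I\subset S$ be a squarefree monomial ideal. Let $\mathcal{P}(S)$ be the set of monomial prime ideals of $S$. The following conditions are equivalent: (a) $I$ is matroidal. (b) For all $P\in\mathcal{P}(S)$ the ideal $I(P)$ is matroidal. (c) For all $P\in\mathcal{P}(S)$ the ideal $I(P)$ is generated in a single degree and has linear quotients with respect to the reverse lexicographic order of its minimal monomial generators. (d) For all $P\in\mathcal{P}(S)$ the ideal $I(P)$ has a linear resolution. (e) For all $P\in\mathcal{P}(S)$ the ideal $I(P)$ is generated in a single degree.
   Context: For a monomial ideal $I$, $G(I)$ denotes its unique minimal set of monomial generators, and $\deg_{x_i}(u)$ is the exponent of $x_i$ in the monomial $u$. $I$ is ''generated in a single degree'' if all elements of $G(I)$ have the same degree. A monomial ideal $I$ is polymatroidal if it is generated in a single degree and, for all $u,v\in G(I)$ and every $i$ with $\deg_{x_i}(u)>\deg_{x_i}(v)$, there exists $j$ with $\deg_{x_j}(u)<\deg_{x_j}(v)$ such that $x_j(u/x_i)\in I$. A matroidal ideal is a squarefree polymatroidal ideal. Monomial prime ideals are the ideals $P_C=(x_i : i\notin C)$ for $C\subseteq[n]=\{1,\ldots,n\}$. The monomial localization $I(P_C)$ of a monomial ideal $I$ with respect to $P_C$ is the monomial ideal obtained from $I$ by substituting $x_i\mapsto 1$ for all $i\in C$; equivalently $I(P_C)=I:(\prod_{i\in C}x_i)^\infty$. A monomial ideal $L$ has linear quotients with respect to an ordering $u_1,\ldots,u_m$ of $G(L)$ if for each $i=2,\ldots,m$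 the colon ideal $(u_1,\ldots,u_{i-1}):u_i$ is generated by a subset of the variables. For the reverse lexicographic order, the generators are listed in decreasing order $u_1>u_2>\cdots>u_m$ with respect to the reverse lexicographic order induced by $x_1>\cdots>x_n$. A graded ideal $L$ has a linear resolution if for some $d$ it has a $d$-linear resolution, i.e. $\mathrm{Tor}_i^S(L,K)_j=0$ for all $i$ and all $j\neq i+d$. *)

(* Defs.v *)
From mathcomp Require Import all_boot all_order all_algebra.
From mathcomp Require Export mpoly.

Set Implicit Arguments.
Unset Strict Implicit.
Unset Printing Implicit Defensive.

Import GRing.Theory.
Local Open Scope ring_scope.

(* The variables are 'X_0, ..., 'X_(n-1); a monomial is identified with its
   exponent vector m : 'X_{1..n}, so that [m i] is the x_i-degree, [mdeg m] the
   degree, and [(u <= v)%MM] is divisibility. *)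

Section Ideals.

Variables (K : fieldType) (n : nat).
Local Notation S := {mpoly K[n]}.

Definition same_ideal (I J : S -> Prop) : Prop := forall f, I f <-> J f.

Definition ideal_gen (A : S -> Prop) : S -> Prop := fun f =>
  exists (r : nat) (c g : 'I_r -> S),
    (forall k, A (g k)) /\ f = \sum_(k < r) c k * g k.

Definition mon_ideal (A : 'X_{1..n} -> Prop) : S -> Prop :=
  ideal_gen (fun f => exists2 m, A m & f = 'X_[m]).

Definition var_ideal (A : {set 'I_n}) : S -> Prop :=
  ideal_gen (fun f => exists2 i, i \in A & f = 'X_i).

Definition colon (J : S -> Prop) (u : S) : S -> Prop := fun f => J (f * u).

Definition monomial_ideal (I : S -> Prop) : Prop :=
  exists A : 'X_{1..n} -> Prop, same_ideal I (mon_ideal A).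

(* [mingen I m] : m belongs to G(I). *)
Definition mingen (I : S -> Prop) (m : 'X_{1..n}) : Prop :=
  I 'X_[m] /\ forall m' : 'X_{1..n}, I 'X_[m'] -> (m' <= m)%MM -> m' = m.

Definition squarefree_monomial_ideal (I : S -> Prop) : Prop :=
  monomial_ideal I /\
  forall m, mingen I m -> forall i : 'I_n, (m i <= 1)%N.

Definition single_degree (I : S -> Prop) : Prop :=
  forall u v, mingen I u -> mingen I v -> mdeg u = mdeg v.

(* Since u i > v i >= 0, the truncated subtraction (u - U_(i))%MM is u / x_i. *)
Definition polymatroidal (I : S -> Prop) : Prop :=
  [/\ monomial_ideal I, single_degree I &
      forall u v, mingen I u -> mingen I v ->
      forall i : 'I_n, (v i < u i)%N ->
      exists2 j : 'I_n, (u j < v j)%N & I 'X_[(U_(j) + (u - U_(i)))%MM]].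

Definition matroidal (I : S -> Prop) : Prop :=
  squarefree_monomial_ideal I /\ polymatroidal I.

(* A monomial prime P_C = (x_i : i \notin C) is represented by C.  The
   substitution image of I is not closed under multiplication by the x_i with
   i \in C, so it is extended back to an ideal of S. *)
Definition monloc (I : S -> Prop) (C : {set 'I_n}) : S -> Prop :=
  ideal_gen (fun g => exists2 f, I f &
    g = f \mPo [tuple (if i \in C then 1 else 'X_i : S) | i < n]).

(* Graded reverse lexicographic order with x_0 > x_1 > ... : in equal degree,
   u > v iff u has the smaller exponent at the last index where they differ.
   (The library's total order on 'X_{1..n} is graded lexicographic.) *)
Definition revlex_gt (u v : 'X_{1..n}) : bool :=
  (mdeg v < mdeg u)%N ||
  (mdeg u == mdeg v) &&
  [exists i : 'I_n, (u i < v i)%N &&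
     [forall j : 'I_n, (i < j)%N ==> (u j == v j)]].

Definition linear_quotients (L : S -> Prop) (s : seq 'X_{1..n}) : Prop :=
  [/\ uniq s, forall m, m \in s <-> mingen L m &
      forall i, (0 < i < size s)%N -> exists A : {set 'I_n},
        same_ideal
          (colon (mon_ideal (fun m => m \in take i s)) 'X_[nth 0%MM s i])
          (var_ideal A)].

Definition revlex_linear_quotients (L : S -> Prop) : Prop :=
  exists2 s, sorted revlex_gt s & linear_quotients L s.

End Ideals.

Section Tor.

Variables (K : fieldType) (n : nat).
Local Notation S := {mpoly K[n]}.

(* Homogeneous maps between the graded free S-modules
   F_i = \bigoplus_(k < rk i) S(- shift i k), elements being row vectors acted
   on from the right, together with an augmentation F_0 -> S. *)
Record graded_free := GradedFree {
  rk : nat -> nat;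
  shift : forall i, 'I_(rk i) -> nat;
  diff : forall i, 'M[S]_(rk i.+1, rk i);
  aug : 'cV[S]_(rk 0);
  diff_homog : forall i k l, diff i k l != 0 ->
    exists2 e, shift k = (shift l + e)%N & diff i k l \is e.-homog;
  aug_homog : forall k, aug k 0 \is (shift k).-homog
}.

(* Exactness of ... -> F_1 -> F_0 -> L -> 0. *)
Definition resolves (F : graded_free) (L : S -> Prop) : Prop :=
  [/\ forall f, L f <-> exists v, v *m aug F = f%:M,
      forall v : 'rV_(rk F 0), v *m aug F = 0 <-> exists w, v = w *m diff F 0 &
      forall i (v : 'rV_(rk F i.+1)),
        v *m diff F i = 0 <-> exists w, v = w *m diff F i.+1].

(* F (x)_S K with K = S / (x_0, ..., x_(n-1)): entries are reduced to their
   constant terms. *)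
Definition kdiff (F : graded_free) i : 'M[K]_(rk F i.+1, rk F i) :=
  map_mx (mcoeff 0%MM) (diff F i).

Definition in_degree (F : graded_free) i (j : nat) (v : 'rV[K]_(rk F i)) :=
  forall k, shift k != j -> v 0 k = 0.

Definition kcycle (F : graded_free) i : 'rV[K]_(rk F i) -> Prop :=
  match i with
  | 0 => fun=> True
  | i'.+1 => fun v => v *m kdiff F i' = 0
  end.

Definition homology_eq0 (F : graded_free) (i j : nat) : Prop :=
  forall v : 'rV[K]_(rk F i), in_degree j v -> kcycle v ->
  exists2 w, in_degree j w & v = w *m kdiff F i.

(* Tor_i^S(L, K)_j = 0, Tor being computed from a graded free resolution of L;
   it does not depend on which one. *)
Definition Tor_eq0 (L : S -> Prop) (i j : nat) : Prop :=
  exists2 F, resolves F L & homology_eq0 F i j.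

Definition linear_resolution (L : S -> Prop) : Prop :=
  exists d : nat, forall i j : nat, j != (i + d)%N -> Tor_eq0 L i j.

End Tor.

(* Main.v *)
Require Import Defs.
From mathcomp Require Import all_boot all_order all_algebra.
From mathcomp Require Import zify ring.
From Stdlib Require Import ClassicalEpsilon.

(** A matroidal ideal has linear quotients, these give a linear resolution, and
    this forces a single degree of generators: these implications hold for each
    ideal separately.  That single degrees in all localizations make an ideal
    matroidal, and that localizations of matroidal ideals are matroidal, are
    basis exchange arguments.

    A squarefree monomial ideal [I] is the same as an upward closed family [U] of
    subsets of the variables (the supports of its monomials); [G(I)] consists of
    the minimal members of [U], the bases.  Substituting 1 for the variables of [C]
    replaces [U] by its link, the sets [B] with [B :|: C] in [U].

    Single degrees force the exchange property: for bases [A], [B] and [i] in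
    [A :\: B], the link of [A :\ i] has the basis [[set i]], so all its bases are
    singletons, and one of them lies in [B] ([exchange_of_links]).  Conversely,
    the bases of any link of a matroid have the same cardinality
    ([equicardinal_link]); as links of links are links, the first argument then
    applies inside each localization and shows that it is matroidal.

    A matroidal ideal has linear quotients in the reverse lexicographic order
    since exchanging the last index in which two bases differ moves the later of
    them forward by one variable ([matroid_revlex_linear_quotients]).

    Linear quotients in degree [d] give a linear resolution: Tor is computed from
    the Taylor complex, whose basis elements are the nonempty sets of
    generators, with their lcm as multidegree.  It is a resolution because in a
    fixed multidegree it is a full simplex ([taylor_resolves]).  Modulo the
    variables only the incidences that preserve the lcm survive, and an acyclic
    matching ([morse_acyclic]) kills all simplices except some critical ones.
    Order the generators as in the linear quotients, and let [v] be the last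
    element of a simplex.  Each variable [x_j] of the colon ideal at [v] has a
    chosen witness, an earlier generator [w] with [w : v = x_j]; a simplex is
    matched by adding or removing the first witness that does not affect its lcm.
    If there is none, the simplex consists of [v] and of witnesses of distinct
    variables, so that [i + 1] elements have an lcm of degree [i + d]
    ([critical_degree]).  All homology in other degrees vanishes.

    Finally the degrees of the minimal generators are seen by Tor_0
    ([Tor0_mingen_degree]). *)

Set Implicit Arguments.
Unset Strict Implicit.
Unset Printing Implicit Defensive.

Import GRing.Theory.

(** * Monomial ideals *)

Section MonomialIdeals.

Variables (K : fieldType) (n : nat).
Local Notation S := {mpoly K[n]}.
Local Open Scope ring_scope.
Implicit Types (I L : S -> Prop) (A : S -> Prop) (f g : S).
Implicit Types (m : 'X_{1..n}) (P : 'X_{1..n} -> Prop).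

Lemma ideal_genM A f g : ideal_gen A g -> ideal_gen A (f * g).
Proof.
move=> [r [c [h [Ah ->]]]]; exists r, (fun k => f * c k), h; split=> //.
by rewrite mulr_sumr; apply: eq_bigr => k _; rewrite mulrA.
Qed.

Lemma ideal_gen_gen A g : A g -> ideal_gen A g.
Proof.
move=> Ag; exists 1%N, (fun=> 1), (fun=> g); split=> //.
by rewrite big_ord_recl big_ord0 mul1r addr0.
Qed.

Lemma ideal_gen0 A : ideal_gen A 0.
Proof.
exists 0%N, (fun=> 0), (fun=> 0); split; first by case.
by rewrite big_ord0.
Qed.

Lemma ideal_genD A f g : ideal_gen A f -> ideal_gen A g -> ideal_gen A (f + g).
Proof.
move=> [r [c [h [Ah ->]]]] [r' [c' [h' [Ah' ->]]]].
pose glue T (x : 'I_r -> T) (y : 'I_r' -> T) k :=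
  match split k with inl i => x i | inr j => y j end.
exists (r + r')%N, (glue _ c c'), (glue _ h h'); split.
  by move=> k; rewrite /glue; case: splitP.
rewrite big_split_ord /=; congr (_ + _); apply: eq_bigr => k _.
  by rewrite /glue (unsplitK (inl k)).
by rewrite /glue (unsplitK (inr k)).
Qed.

Lemma ideal_gen_sum A (T : eqType) (r : seq T) (F : T -> S) :
  (forall t, t \in r -> ideal_gen A (F t)) -> ideal_gen A (\sum_(t <- r) F t).
Proof.
elim: r => [|t r IH] AF; first by rewrite big_nil; apply: ideal_gen0.
rewrite big_cons; apply: ideal_genD; first by apply: AF; rewrite mem_head.
by apply: IH => u ru; apply: AF; rewrite inE ru orbT.
Qed.

Lemma msuppM_up P f g : (forall m m', (m <= m')%MM -> P m -> P m') ->
  (forall m, m \in msupp g -> P m) -> forall m, m \in msupp (f * g) -> P m.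
Proof.
move=> upP Pg m /msuppM_le /allpairsP [[m1 m2] /= [_ gm2 ->]].
by apply: upP (Pg _ gm2); apply: lem_addl.
Qed.

(** All the monomial ideals at hand (generated by monomials, by variables, or by
    the substitution images that define a localization) are given by generators
    but used through the monomials that they contain; this is the passage from
    the former to the latter. *)
Lemma ideal_gen_monomialP A P f :
    (forall m m', (m <= m')%MM -> P m -> P m') ->
    (forall g, A g -> forall m, m \in msupp g -> P m) ->
    (forall m, P m -> ideal_gen A 'X_[m]) ->
  ideal_gen A f <-> (forall m, m \in msupp f -> P m).
Proof.
move=> upP AP PA; split=> [[r [c [g [Ag ->]]]] | Pf].
  move=> m /msupp_sum_le /flattenP [s /mapP [k _ ->]].
  by apply: msuppM_up => // m'; apply: AP.
rewrite [f]mpolyE; apply: ideal_gen_sum => m fm.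
by rewrite -mul_mpolyC; apply/ideal_genM/PA/Pf.
Qed.

Lemma ideal_gen_dvd A m m' :
  (m <= m')%MM -> ideal_gen A 'X_[m] -> ideal_gen A 'X_[m'].
Proof. by move=> /submK <-; rewrite mpolyXD; apply: ideal_genM. Qed.

Lemma mon_idealP (A : 'X_{1..n} -> Prop) f : mon_ideal A f <->
  (forall m, m \in msupp f -> exists2 a, A a & (a <= m)%MM).
Proof.
apply: ideal_gen_monomialP => [m m' mm' [a Aa am]|g [a Aa ->] m|m [a Aa am]].
- by exists a => //; apply: lepm_trans mm'.
- by rewrite msuppX inE => /eqP ->; exists a => //; apply: lepm_refl.
by apply/(ideal_gen_dvd am)/ideal_gen_gen; exists a.
Qed.

Lemma lem_mnm1 i m : (U_(i) <= m)%MM = (0 < m i)%N.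
Proof.
apply/mnm_lepP/idP => [/(_ i)|mi j]; rewrite ?mnm1E ?eqxx //.
by case: eqP => // <-.
Qed.

Lemma var_idealP (A : {set 'I_n}) f : var_ideal A f <->
  (forall m, m \in msupp f -> exists2 i, i \in A & (0 < m i)%N).
Proof.
apply: ideal_gen_monomialP => [m m' mm' [i Ai mi]|g [i Ai ->] m|m [i Ai mi]].
- by exists i => //; apply: leq_trans mi (mnm_lepP mm' i).
- by rewrite msuppX inE => /eqP ->; exists i; rewrite // mnm1E eqxx.
by apply: (@ideal_gen_dvd _ U_(i)); rewrite ?lem_mnm1 //;
  apply: ideal_gen_gen; exists i.
Qed.

Lemma colon_mon_idealP (A : 'X_{1..n} -> Prop) v f :
  colon (mon_ideal A) 'X_[v] f <->
  (forall m, m \in msupp f -> exists2 a, A a & (a <= m + v)%MM).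
Proof.
rewrite /colon mon_idealP; split=> Af m.
  by move=> fm; apply: Af; rewrite addmC (perm_mem (msuppMX _ _)) map_f.
by rewrite (perm_mem (msuppMX _ _)) => /mapP [m' /Af + ->]; rewrite addmC.
Qed.

Lemma monomial_idealP I : monomial_ideal I -> forall f,
  I f <-> (forall m, m \in msupp f -> I 'X_[m]).
Proof.
move=> [A IA] f; rewrite IA mon_idealP; split=> If m /If.
  by move=> Am; apply/IA/mon_idealP => m'; rewrite msuppX inE => /eqP ->.
by move/IA/mon_idealP; apply; rewrite msuppX inE.
Qed.

Lemma monomial_ideal_dvd I m m' : monomial_ideal I ->
  (m <= m')%MM -> I 'X_[m] -> I 'X_[m'].
Proof. by move=> [A IA] mm' /IA Im; apply/IA/(ideal_gen_dvd mm'). Qed.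

Lemma mingen_below I m : I 'X_[m] -> exists2 u, mingen I u & (u <= m)%MM.
Proof.
have [d] := ubnP (mdeg m); elim: d m => // d IH m md Im.
have [[m' [Im' m'm nm]]|nomin] := classic
    (exists m', [/\ I 'X_[m'], (m' <= m)%MM & m' <> m]); last first.
  exists m; last exact: lepm_refl.
  split=> // m' Im' m'm; have [//|/eqP ne] := eqVneq m' m.
  by case: nomin; exists m'.
have ltd : (mdeg m' < mdeg m)%N.
  rewrite -(submK m'm) mdegD -[ltnLHS]add0n ltn_add2r lt0n mdeg_eq0.
  by apply/eqP => e; apply: nm; rewrite -(submK m'm) e add0m.
have [u uI um] := IH m' (leq_trans ltd md) Im'.
by exists u => //; apply: lepm_trans m'm.
Qed.

Lemma monomial_ideal_mingenP I : monomial_ideal I -> forall f,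
  I f <-> (forall m, m \in msupp f -> exists2 u, mingen I u & (u <= m)%MM).
Proof.
move=> monI f; rewrite (monomial_idealP monI); split=> If m /If.
  exact: mingen_below.
by move=> [u [Iu _] um]; apply: monomial_ideal_dvd Iu.
Qed.

End MonomialIdeals.

(** * Basis exchange in upward closed set families *)

Section SetFamilies.

Variable T : finType.
Implicit Types (U : {set {set T}}) (A B C D : {set T}).

Definition upset U := forall A B, A \subset B -> A \in U -> B \in U.

Definition basis U B := minset [in U] B.

Definition equicardinal U := forall A B, basis U A -> basis U B -> #|A| = #|B|.

Definition exchange U := forall A B i, basis U A -> basis U B ->
  i \in A :\: B -> exists2 j, j \in B :\: A & j |: A :\ i \in U.

(** The family of the localization: inverting the variables of [C] removes the
    elements of [C] from the members of [U]. *)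
Definition link U C := [set B | B :|: C \in U].

Lemma upset_link U C : upset U -> upset (link U C).
Proof. by move=> upU A B AB; rewrite !inE; apply/upU/setSU. Qed.

Lemma basisP U B : reflect
  (B \in U /\ forall A, A \in U -> A \subset B -> A = B) (basis U B).
Proof. exact: minsetP. Qed.

Lemma basis_in U B : basis U B -> B \in U.
Proof. by case/basisP. Qed.

Lemma basis_min U A B : basis U B -> A \in U -> A \subset B -> A = B.
Proof. by case/basisP => _ minB UA AB; apply: minB. Qed.

Lemma basis_below U B : B \in U -> exists2 A, basis U A & A \subset B.
Proof. by case/minset_exists => A; exists A. Qed.

Lemma basis_card U A B :
  equicardinal U -> basis U A -> B \in U -> #|B| = #|A| -> basis U B.
Proof.
move=> eqU bA UB eBA; have [D bD DB] := basis_below UB.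
suff <- : D = B by [].
by apply/eqP; rewrite eqEcard DB eBA (eqU _ _ bA bD) /=.
Qed.

Lemma card_swap A i j : i \in A -> j \notin A -> #|j |: A :\ i| = #|A|.
Proof.
move=> Ai Aj; rewrite cardsU1 !inE (negbTE Aj) andbF /= (cardsD1 i A) Ai.
by [].
Qed.

(** The set [A :\ i] leaves [[set i]] as a basis of its link, so all bases of
    this link are singletons; one of them lies in [B], and it is the element to
    be exchanged for [i]. *)
Lemma exchange_of_links U :
  upset U -> (forall C, equicardinal (link U C)) -> exchange U.
Proof.
move=> upU eqU A B i bA bB /setDP [Ai nBi].
have UA := basis_in bA.
have bi : basis (link U (A :\ i)) [set i].
  apply/basisP; split=> [|D]; first by rewrite inE setD1K.
  rewrite inE subset1 => UD /orP [/eqP //|/eqP D0].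
  move: UD; rewrite D0 set0U => UAi.
  by move: Ai; rewrite -(basis_min bA UAi (subD1set _ _)) !inE eqxx.
have [|D bD DB] := @basis_below (link U (A :\ i)) (B :\: (A :\ i)).
  by rewrite inE; apply: upU (basis_in bB); apply/subsetP => x Bx;
     rewrite in_setU in_setD Bx andbT orNb.
have /eqP/cards1P [j Dj] : #|D| = 1 by rewrite (eqU _ _ _ bD bi) cards1.
move/basis_in: bD; rewrite Dj inE => Uj; exists j => //.
move: DB; rewrite Dj sub1set !inE negb_and negbK => /andP [/orP [/eqP ->|->] Bj //].
by rewrite Bj in nBi.
Qed.

(** The dual exchange property: here the element [j] that enters is given.
    Exchanges that keep [j] move [B] towards [A] until [j] is the only element
    outside [A]; the basis reached is [j |: A :\ i]. *)
Lemma dual_exchange U A B j : upset U -> equicardinal U -> exchange U ->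
    basis U A -> basis U B -> j \in B :\: A ->
  exists2 i, i \in A :\: B & j |: A :\ i \in U.
Proof.
move=> upU eqU exU bA bB /setDP [Bj nAj].
suff walk d W : #|W :\: A| < d -> basis U W -> A :&: B \subset W -> j \in W ->
    exists2 i, i \in A :\: B & j |: A :\ i \in U.
  by apply: (walk #|B :\: A|.+1 B) => //; apply: subsetIr.
elim: d W => // d IH W Wd bW ABW Wj.
have [WA|nWA] := eqVneq (W :\: A) [set j].
  have : #|A :\: W| = 1.
    move: (cardsID A W) (cardsID W A) (eqU _ _ bA bW).
    by rewrite WA cards1 setIC; lia.
  move/eqP/cards1P => [i AWi].
  have /setDP [Ai nWi] : i \in A :\: W by rewrite AWi set11.
  exists i.
    rewrite inE Ai andbT; apply: contra nWi => Bi.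
    by apply: (subsetP ABW); rewrite inE Ai.
  apply: upU (basis_in bW); apply/subsetP => x Wx; rewrite !inE.
  have [//|nxj /=] := eqVneq x j.
  have [xi|_ /=] := eqVneq x i; first by rewrite -xi Wx in nWi.
  apply: contraNT nxj => nAx.
  by rewrite -in_set1 -WA inE nAx.
have [k /setDP [Wk nAk] nkj] : exists2 k, k \in W :\: A & k != j.
  apply/exists_inP; apply: contraNT nWA; rewrite negb_exists_in => /forall_inP h.
  apply/eqP/setP => x; rewrite in_set1; apply/idP/eqP => [/h /negPn /eqP //|->].
  by rewrite inE nAj.
have [|l /setDP [Al nWl] Ul] := exU _ _ k bW bA; first by rewrite inE nAk.
have bl : basis U (l |: W :\ k) by apply: basis_card bW Ul _ => //; apply: card_swap.
apply: IH bl _ _.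
- rewrite -ltnS; apply: leq_trans _ Wd; rewrite ltnS.
  apply/proper_card/properP; split.
    apply/subsetP => x; rewrite !inE => /andP [nAx /orP [/eqP xl|/andP [_ Wx]]].
      by rewrite xl Al in nAx.
    by rewrite nAx.
  exists k; rewrite !inE ?nAk // eqxx /= orbF.
  by apply: contra nAk => /eqP ->.
- apply/subsetP => x ABx; rewrite !inE (subsetP ABW _ ABx) andbT.
  have [xk|_] := eqVneq x k; last by rewrite orbT.
  by move: ABx; rewrite xk inE (negbTE nAk).
by rewrite !inE Wj (eq_sym j k) nkj orbT.
Qed.

(** Every basis of a link is [B :\: C] for a basis [B].  If [#|A :\: C|] were
    smaller than [#|B :\: C|], then [A] would have an element of [C] that is not
    in [B]; let it enter [B] by dual exchange.  Either an element outside [C]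
    leaves, against the minimality of [B :\: C], or [B] comes closer to [A]. *)
Lemma equicardinal_link U C :
  upset U -> equicardinal U -> exchange U -> equicardinal (link U C).
Proof.
move=> upU eqU exU.
have lift D : basis (link U C) D -> exists2 B, basis U B & B :\: C = D.
  move=> bD; have := basis_in bD; rewrite inE => /basis_below [B bB BD].
  exists B => //; apply: (basis_min bD); last by rewrite subDset setUC.
  by rewrite inE; apply: upU (basis_in bB); rewrite setUC -subDset.
suff no_less d A B : #|A :\: B| < d -> basis U A -> basis U B ->
    basis (link U C) (B :\: C) -> #|A :\: C| < #|B :\: C| -> False.
  move=> D E bD bE; have [A bA AD] := lift D bD; have [B bB BE] := lift E bE.
  subst D E; have [lt|lt|//] := ltngtP #|A :\: C| #|B :\: C|.
    by case: (no_less _ _ _ (ltnSn _) bA bB bE lt).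
  by case: (no_less _ _ _ (ltnSn _) bB bA bD lt).
elim: d A B => // d IH A B ABd bA bB bBC ltAB.
have [j jA jB] : exists2 j, j \in A :&: C & j \notin B.
  have : ~~ (A :&: C \subset B :&: C).
    apply/negP => /subset_leq_card.
    by move: (cardsID C A) (cardsID C B) (eqU _ _ bA bB) ltAB; lia.
  move/subsetPn => [j jA]; rewrite inE negb_and => jB; exists j => //.
  by move: jA jB; rewrite inE => /andP [_ ->]; rewrite orbF.
have [Aj Cj] := setIP jA.
have [|i /setDP [Bi nAi] Ui] := dual_exchange (j := j) upU eqU exU bB bA.
  by rewrite inE jB.
have bBi : basis U (j |: B :\ i) by apply: basis_card bB Ui _ => //; apply: card_swap.
have [Ci|nCi] := boolP (i \in C).
  have eC : (j |: B :\ i) :\: C = B :\: C.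
    apply/setP => x; rewrite !inE; have [//|nCx /=] := boolP (x \in C).
    have [xj|_ /=] := eqVneq x j; first by rewrite xj Cj in nCx.
    by have [xi|//] := eqVneq x i; rewrite xi Ci in nCx.
  apply: IH bA bBi _ _; rewrite ?eC //.
  rewrite -ltnS; apply: leq_trans _ ABd; rewrite ltnS.
  apply/proper_card/properP; split.
    apply/subsetP => x; rewrite !inE => /andP [h Ax]; rewrite Ax andbT.
    apply: contra h => Bx; have [xi|_] := eqVneq x i; last by rewrite Bx orbT.
    by rewrite xi (negbTE nAi) in Ax.
  by exists j; rewrite !inE ?jB ?eqxx.
have : B :\: C :\ i = B :\: C.
  apply: (basis_min bBC); last exact: subD1set.
  rewrite inE; apply: upU Ui; apply/subsetP => x; rewrite !inE.
  have [->|_ /=] := eqVneq x j; first by rewrite Cj orbT.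
  by move=> /andP [-> ->]; rewrite andbT orNb.
by move/setP/(_ i); rewrite !inE eqxx Bi nCi.
Qed.

End SetFamilies.

(** * Squarefree monomial ideals and set families *)

Section SquarefreeIdeals.

Variables (K : fieldType) (n : nat).
Local Notation S := {mpoly K[n]}.
Local Open Scope ring_scope.
Implicit Types (I : S -> Prop) (U : {set {set 'I_n}}) (B C : {set 'I_n}).
Implicit Types (m : 'X_{1..n}) (f : S).

Definition supp m : {set 'I_n} := [set i | 0 < m i]%N.

(** [mesym1 B] is the squarefree monomial with support [B]. *)
Definition family_of I : {set {set 'I_n}} :=
  [set B | excluded_middle_informative (I 'X_[mesym1 B])].

Definition given_by I U := forall f,
  I f <-> (forall m, m \in msupp f -> supp m \in U).

Lemma supp_mesym1 B : supp (mesym1 B) = B.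
Proof. by apply/setP => i; rewrite inE mnmE; case: (i \in B). Qed.

Lemma supp_sub m m' : (m <= m')%MM -> supp m \subset supp m'.
Proof.
move/mnm_lepP => mm'; apply/subsetP => i; rewrite !inE => mi.
exact: leq_trans mi (mm' i).
Qed.

Lemma mesym1_le B m : (mesym1 B <= m)%MM = (B \subset supp m).
Proof.
apply/idP/idP => [/supp_sub|/subsetP Bm]; first by rewrite supp_mesym1.
by apply/mnm_lepP => i; rewrite mnmE; case: (boolP (i \in B)) => // /Bm; rewrite inE.
Qed.

Lemma family_ofP I B : reflect (I 'X_[mesym1 B]) (B \in family_of I).
Proof. by rewrite inE; apply: sumboolP. Qed.

Lemma upset_family_of I : monomial_ideal I -> upset (family_of I).
Proof.
move=> monI A B AB /family_ofP IA; apply/family_ofP.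
by apply: monomial_ideal_dvd IA => //; rewrite mesym1_le supp_mesym1.
Qed.

Lemma squarefree_given_by I :
  squarefree_monomial_ideal I -> given_by I (family_of I).
Proof.
move=> [monI sqI] f; rewrite (monomial_idealP monI).
split=> If m fm.
  have [u uI um] := mingen_below (If _ fm).
  apply/family_ofP/(monomial_ideal_dvd monI _ (proj1 uI))/mnm_lepP => i.
  rewrite mnmE inE; case: posnP => [mi0|_]; last exact: sqI.
  by rewrite -[nat_of_bool false]mi0; apply: (mnm_lepP um).
move/family_ofP: (If _ fm); apply: monomial_ideal_dvd => //.
by rewrite mesym1_le.
Qed.

Section GivenBy.

Variables (I : S -> Prop) (U : {set {set 'I_n}}).
Hypotheses (upU : upset U) (IU : given_by I U).

Lemma given_byX m : I 'X_[m] <-> supp m \in U.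
Proof.
rewrite IU; split=> [|Um m']; first by apply; rewrite msuppX inE.
by rewrite msuppX inE => /eqP ->.
Qed.

Lemma mingenP m : mingen I m <-> exists2 B, basis U B & m = mesym1 B.
Proof.
split=> [[/given_byX Um minm]|[B bB ->]].
  have [B bB Bm] := basis_below Um; exists B => //.
  apply/esym/minm; last by rewrite mesym1_le.
  by apply/given_byX; rewrite supp_mesym1; apply: basis_in.
split=> [|m' /given_byX Um' m'B].
  by apply/given_byX; rewrite supp_mesym1; apply: basis_in.
apply/mnmP => i; apply/eqP; rewrite eqn_leq (mnm_lepP m'B) /=.
apply/(mnm_lepP _ i); rewrite mesym1_le.
by rewrite (basis_min bB Um') // -[B]supp_mesym1 supp_sub.
Qed.

Lemma given_by_squarefree : squarefree_monomial_ideal I.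
Proof.
split=> [|m /mingenP [B _ ->] i]; last by rewrite mnmE leq_b1.
exists (fun m => supp m \in U) => f; rewrite IU mon_idealP.
split=> If m /If => [Um|[a Ua am]]; last exact: upU (supp_sub am) Ua.
by exists m => //; apply: lepm_refl.
Qed.

Lemma single_degreeP : single_degree I <-> equicardinal U.
Proof.
split=> [sdI A B bA bB|eqU u v].
  by rewrite -!mdeg_mesym1; apply: sdI; apply/mingenP; [exists A|exists B].
by move=> /mingenP [A bA ->] /mingenP [B bB ->]; rewrite !mdeg_mesym1; apply: eqU.
Qed.

Lemma mesym1_lt A B (i : 'I_n) :
  (mesym1 B i < mesym1 A i)%N = (i \in A :\: B).
Proof. by rewrite !mnmE inE; case: (i \in A); case: (i \in B). Qed.

Lemma supp_swap A i j :
  supp (U_(j) + (mesym1 A - U_(i)))%MM = j |: A :\ i.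
Proof.
apply/setP => x; rewrite !inE !mnmE (eq_sym j) (eq_sym i).
by case: (x == j); case: (x == i); case: (x \in A).
Qed.

Lemma matroidalP : matroidal I <-> equicardinal U /\ exchange U.
Proof.
split=> [[_ [_ sdI exI]]|[eqU exU]].
  split=> [|A B i bA bB iAB]; first exact/single_degreeP.
  have gA : mingen I (mesym1 A) by apply/mingenP; exists A.
  have gB : mingen I (mesym1 B) by apply/mingenP; exists B.
  have [|j] := exI _ _ gA gB i; first by rewrite mesym1_lt.
  by rewrite mesym1_lt => jBA /given_byX; rewrite supp_swap; exists j.
split; first exact: given_by_squarefree.
split; [by case: given_by_squarefree | exact/single_degreeP |].
move=> u v /mingenP [A bA ->] /mingenP [B bB ->] i; rewrite mesym1_lt.
move=> /(exU _ _ _ bA bB) [j jBA Uj]; exists j; first by rewrite mesym1_lt.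
by apply/given_byX; rewrite supp_swap.
Qed.

(** The substitution deletes the part of each monomial in the variables of [C];
    so a monomial can be multiplied by these variables before it is tested for
    membership in [I]. *)
Lemma given_by_monloc C : given_by (monloc I C) (link U C).
Proof.
pose off m := [multinom (if i \in C then 0 else m i)%N | i < n].
have subX m : 'X_[m] \mPo [tuple (if i \in C then 1 else 'X_i : S) | i < n]
    = 'X_[off m].
  rewrite comp_mpolyX mpolyXE_id; apply: eq_bigr => i _.
  by rewrite tnth_mktuple mnmE; case: (i \in C); rewrite /= ?expr1n.
move=> f; apply: ideal_gen_monomialP => [m m' mm'|_ [g Ig ->] m|m].
- by apply: upset_link => //; apply: supp_sub.
- rewrite comp_mpolyEX => /msupp_sum_le /flattenP [s /mapP [m' gm' ->]].
  move/msuppZ_le; rewrite subX msuppX inE => /eqP ->; rewrite inE.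
  move: gm'; rewrite mem_filter => /(proj1 (IU g) Ig); apply: upU.
  by apply/subsetP => x; rewrite !inE mnmE; case: (x \in C); rewrite ?orbT ?orbF.
rewrite inE => Um; apply: (@ideal_gen_dvd _ _ _ (off (mesym1 (supp m :|: C)))).
  apply/mnm_lepP => i; rewrite !mnmE !inE; case: (i \in C) => //.
  by rewrite orbF; case: (m i).
apply: ideal_gen_gen; exists 'X_[mesym1 (supp m :|: C)]; last by rewrite subX.
by apply/given_byX; rewrite supp_mesym1.
Qed.

End GivenBy.

(** The bases of every localization are equicardinal.  Since the localizations of
    a localization of [I] are localizations of [I], the basis exchange in
    [monloc I C] follows from equicardinality alone. *)
Lemma matroidal_monloc I C : matroidal I -> matroidal (monloc I C).
Proof.
move=> mI; have [sqI _] := mI.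
have IU := squarefree_given_by sqI; have upU := upset_family_of (proj1 sqI).
move/(matroidalP upU IU): mI => [eqU exU].
have eqL D : equicardinal (link (family_of I) D) by apply: equicardinal_link.
apply/(matroidalP (upset_link upU) (given_by_monloc upU IU C)); split=> //.
apply: exchange_of_links => [|D]; first exact: upset_link.
suff -> : link (link (family_of I) C) D = link (family_of I) (D :|: C) by [].
by apply/setP => B; rewrite !inE setUA.
Qed.

Lemma matroidal_of_single_degree I : squarefree_monomial_ideal I ->
  (forall C, single_degree (monloc I C)) -> matroidal I.
Proof.
move=> sqI sd.
have IU := squarefree_given_by sqI; have upU := upset_family_of (proj1 sqI).
have eqL D : equicardinal (link (family_of I) D).
  exact/(single_degreeP (given_by_monloc upU IU D)).
apply/(matroidalP upU IU); split; last exact: exchange_of_links.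
suff <- : link (family_of I) set0 = family_of I by [].
by apply/setP => B; rewrite inE setU0.
Qed.

End SquarefreeIdeals.

(** * Linear quotients of matroidal ideals *)

Section Revlex.

Variable n : nat.
Implicit Types u v w : 'X_{1..n}.

Lemma revlex_gt_irr u : revlex_gt u u = false.
Proof.
by rewrite /revlex_gt ltnn eqxx /=; apply/existsP => [[i]]; rewrite ltnn.
Qed.

Lemma revlex_gt_trans : transitive (@revlex_gt n).
Proof.
move=> v u w; rewrite /revlex_gt.
have [uv|vu|euv] /= := ltngtP (mdeg u) (mdeg v); first by [].
  by have [vw|wv|<-] //= := ltngtP (mdeg v) (mdeg w); rewrite ?vu // (ltn_trans wv).
rewrite euv; have [//|//|_ /=] := ltngtP (mdeg v) (mdeg w).
move=> /existsP [i /andP [ui /forallP hi]] /existsP [j /andP [vj /forallP hj]].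
apply/existsP; exists (if i < j then j else i).
have [ij|ji] := ltnP i j; apply/andP; split.
- by rewrite (eqP (implyP (hi j) ij)).
- apply/forallP => k; apply/implyP => jk.
  by rewrite (eqP (implyP (hi k) (ltn_trans ij jk))); apply: (implyP (hj k)).
- move: ji; rewrite leq_eqVlt => /orP [/eqP/val_inj ji|ji].
    by apply: ltn_trans ui _; rewrite -ji.
  by rewrite -(eqP (implyP (hj i) ji)).
apply/forallP => k; apply/implyP => ik.
by rewrite (eqP (implyP (hi k) ik)); apply: (implyP (hj k)); apply: leq_ltn_trans ik.
Qed.

Lemma revlex_gt_total u v : u != v -> revlex_gt u v || revlex_gt v u.
Proof.
move=> nuv; rewrite /revlex_gt; have [//|//|_ /=] := ltngtP (mdeg u) (mdeg v).
have [i0 ni0] : exists i, u i != v i.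
  apply/existsP; apply: contraNT nuv; rewrite negb_exists => /forallP uv.
  by apply/eqP/mnmP => i; apply/eqP; rewrite -[_ == _]negbK.
case: (@arg_maxnP _ i0 (fun i => u i != v i) val) => //= i ni maxi.
have agree (j : 'I_n) : i < j -> u j = v j.
  by move=> ij; apply/eqP; apply: contraTT ij => /maxi; rewrite -leqNgt.
have [lt|gt|/eqP] := ltngtP (u i) (v i); last by rewrite (negbTE ni).
  apply/orP; left; apply/existsP; exists i; rewrite lt.
  by apply/forallP => j; apply/implyP => /agree ->.
apply/orP; right; apply/existsP; exists i; rewrite gt.
by apply/forallP => j; apply/implyP => /agree ->.
Qed.

Lemma revlex_sort (s : seq 'X_{1..n}) : uniq s ->
  exists2 t, sorted (@revlex_gt n) t & perm_eq t s.
Proof.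
move=> us; pose e u v := revlex_gt u v || (u == v).
have e_total : total e.
  move=> u v; rewrite /e (eq_sym v); have [_|/revlex_gt_total] := eqVneq u v.
    by rewrite orbT.
  by rewrite !orbF.
have e_trans : transitive e.
  move=> v u w /orP [uv|/eqP -> //] /orP [vw|/eqP <-]; last by rewrite /e uv.
  by rewrite /e (revlex_gt_trans uv vw).
exists (sort e s); last by rewrite perm_sort.
have : pairwise [rel u v | e u v && (u != v)] (sort e s).
  rewrite pairwise_relI -(sorted_pairwise e_trans) (sort_sorted e_total) /=.
  by rewrite -uniq_pairwise sort_uniq.
rewrite (sorted_pairwise revlex_gt_trans); apply: sub_pairwise => u v /=.
by rewrite /e; case: eqP; rewrite ?andbF // orbF andbT.
Qed.

Lemma mem_take_revlex (s : seq 'X_{1..n}) i u : sorted (@revlex_gt n) s ->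
  i < size s -> u \in s -> (u \in take i s) = revlex_gt u (nth 0%MM s i).
Proof.
move=> srt isz us; have usz : index u s < size s by rewrite index_mem.
have nths j k := @sorted_ltn_nth _ _ revlex_gt_trans 0%MM s srt j k.
rewrite in_take //; apply/idP/idP => [ui|].
  by rewrite -[X in revlex_gt X _](nth_index 0%MM us); apply: nths.
apply: contraTT; rewrite -leqNgt leq_eqVlt => /orP [/eqP ->|iu].
  by rewrite nth_index ?revlex_gt_irr.
apply/negP => ugt; have := nths _ _ isz usz iu; rewrite nth_index // => gtu.
by have := revlex_gt_trans ugt gtu; rewrite revlex_gt_irr.
Qed.

End Revlex.

Section LinearQuotients.

Variables (K : fieldType) (n : nat).
Local Notation S := {mpoly K[n]}.
Variables (L : S -> Prop) (U : {set {set 'I_n}}).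
Hypothesis LU : given_by L U.
Hypotheses (eqU : equicardinal U) (exU : exchange U).

(** If [D] precedes [B], the last index [k] where they differ belongs to [B].
    Exchanging it for some [j] of [D] gives a basis that precedes [B], because
    [j] comes before [k]; this basis contributes the variable [j] to the colon
    ideal, and [j] divides the contribution of [D]. *)
Lemma matroid_revlex_linear_quotients : revlex_linear_quotients L.
Proof.
pose s0 := [seq mesym1 B | B in [pred B | basis U B]].
have us0 : uniq s0.
  rewrite map_inj_uniq ?enum_uniq // => A B AB.
  by rewrite -[A]supp_mesym1 -[B]supp_mesym1 AB.
have [s srt ss0] := revlex_sort us0.
have memsP m : reflect (exists2 B, basis U B & m = mesym1 B) (m \in s).
  by rewrite (perm_mem ss0); apply: imageP.
exists s => //; split=> [|m|i /andP [_ isz]]; first by rewrite (perm_uniq ss0).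
  split=> [/memsP ?|/(mingenP LU) ?]; last exact/memsP.
  exact/(mingenP LU).
have [B bB vB] := memsP _ (mem_nth 0%MM isz).
pose A := [set j | (j \notin B) &&
  [exists k, [&& k \in B, (j < k) & j |: B :\ k \in U]]].
exists A => f; rewrite colon_mon_idealP var_idealP vB.
suff colonE m : (exists2 a, a \in take i s & (a <= m + mesym1 B)%MM) <->
    (exists2 j, j \in A & 0 < m j).
  by split=> h m /h /colonE.
split=> [[a /[dup] /mem_take sa]|[j]].
  rewrite mem_take_revlex // vB => aB am.
  have [D bD aD] := memsP _ sa.
  move: aB; rewrite aD /revlex_gt !mdeg_mesym1 (eqU bB bD) ltnn eqxx /=.
  move=> /existsP [k /andP [kBD /forallP agree]]; rewrite mesym1_lt in kBD.
  have [j /setDP [Dj nBj] Uj] := exU bB bD kBD.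
  exists j.
    rewrite inE nBj; apply/existsP; exists k; rewrite Uj andbT.
    have /setDP [-> nDk] /= := kBD; rewrite ltnNge; apply/negP.
    rewrite leq_eqVlt => /orP [/eqP/val_inj kj|kj]; first by rewrite kj Dj in nDk.
    by move: (implyP (agree j) kj); rewrite !mnmE Dj (negbTE nBj).
  by move/mnm_lepP/(_ j): am; rewrite aD !mnmE Dj (negbTE nBj) addn0.
rewrite inE => /andP [nBj /existsP [k /and3P [Bk jk Uj]]] mj.
have bj : basis U (j |: B :\ k) by apply: basis_card bB Uj _ => //; apply: card_swap.
exists (mesym1 (j |: B :\ k)).
  rewrite mem_take_revlex ?vB //; last by apply/memsP; exists (j |: B :\ k).
  rewrite /revlex_gt !mdeg_mesym1 (eqU bB bj) ltnn eqxx /=.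
  apply/existsP; exists k; rewrite mesym1_lt !inE Bk eqxx orbF.
  apply/andP; split; first by case: eqP jk => // ->; rewrite ltnn.
  apply/forallP => l; apply/implyP => kl; rewrite !mnmE !inE.
  have [lj|_] := eqVneq l j; first by move: (ltn_trans jk kl); rewrite lj ltnn.
  by have [lk|//] := eqVneq l k; rewrite lk ltnn in kl.
apply/mnm_lepP => l; rewrite !mnmE !inE; have [->|_] := eqVneq l j.
  by rewrite (negbTE nBj) addn0.
by apply: leq_trans (leq_addl _ _); case: (l != k).
Qed.

End LinearQuotients.

(** * Weighted simplicial boundaries and algebraic Morse theory *)

Section Boundary.

Local Open Scope ring_scope.
Variables (R : comNzRingType) (N : nat).
Implicit Types (s : {set 'I_N}) (t u : 'I_N) (c : {set 'I_N} -> R).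

Definition sgn s t : R := (-1) ^+ #|[set u in s | (u < t)%N]|.

Lemma sgnK s t : sgn s t * sgn s t = 1.
Proof. by rewrite -expr2 sqrr_sign. Qed.

Lemma sgn0 t : sgn set0 t = 1.
Proof.
rewrite /sgn; suff -> : [set u : 'I_N in set0 | (u < t)%N] = set0 by rewrite cards0.
by apply/setP => u; rewrite !inE.
Qed.

Lemma sgnU s t u : t \notin s -> sgn (t |: s) u = (-1) ^+ (t < u)%N * sgn s u.
Proof.
move=> ts; rewrite /sgn -exprD; congr (_ ^+ _).
rewrite (cardsD1 t) !inE eqxx /=; congr (_ + _)%N.
apply: eq_card => x; rewrite !inE; have [->|] := eqVneq x t; rewrite //=.
by rewrite (negbTE ts).
Qed.

Lemma sgn_swap s t u : t != u -> t \notin s -> u \notin s ->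
  sgn s t * sgn (t |: s) u = - (sgn s u * sgn (u |: s) t).
Proof.
move=> tu ts us; rewrite !sgnU //.
have [lt|lt|/val_inj eq_tu] := ltngtP t u; last by rewrite eq_tu eqxx in tu.
  by rewrite expr0 expr1; ring.
by rewrite expr0 expr1; ring.
Qed.

(** The simplicial boundary with weights on the incidences, written through the
    coefficient of a face [s]: hence the sum over the cofaces of [s]. *)
Definition bd (a : {set 'I_N} -> 'I_N -> R) c s : R :=
  \sum_(t | t \notin s) sgn s t * a s t * c (t |: s).

(** The terms are cancelled in pairs, as 2 may be a zero divisor. *)
Lemma sum_antisym (F : 'I_N -> 'I_N -> R) (P : pred 'I_N) :
    (forall t u, t != u -> P t -> P u -> F t u = - F u t) ->
  \sum_(t | P t) \sum_(u | P u && (u != t)) F t u = 0.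
Proof.
move=> Fanti.
have split_lt t : P t -> \sum_(u | P u && (u != t)) F t u =
    \sum_(u | P u && (t < u)%N) F t u + \sum_(u | P u && (u < t)%N) F t u.
  move=> Pt; rewrite (bigID (fun u : 'I_N => (t < u)%N)) /=; congr (_ + _);
    apply: eq_bigl => u; rewrite -andbA; congr (_ && _); rewrite -val_eqE /=; lia.
rewrite (eq_bigr _ split_lt) big_split /=.
rewrite [X in _ + X](exchange_big_dep P) /=; last by move=> t u _ /andP [].
rewrite -big_split /= big1 // => t Pt; rewrite [X in _ + X](eq_bigl
  (fun u => P u && (t < u)%N)); last by move=> u; rewrite Pt.
rewrite -big_split big1 //= => u /andP [Pu tu]; rewrite Fanti ?addNr //.
by rewrite -val_eqE neq_ltn tu.
Qed.

Lemma bd_bd a c :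
    (forall s t u, a s t * a (t |: s) u = a s u * a (u |: s) t) ->
  forall s, bd a (bd a c) s = 0.
Proof.
move=> aC s; pose F t u :=
  sgn s t * a s t * (sgn (t |: s) u * a (t |: s) u * c (u |: (t |: s))).
transitivity (\sum_(t | t \notin s) \sum_(u | (u \notin s) && (u != t)) F t u).
  apply: eq_bigr => t ts; rewrite /bd mulr_sumr; apply: eq_bigl => u.
  by rewrite !inE negb_or andbC.
apply: sum_antisym => t u tu ts us; rewrite /F [u |: (t |: s)]setUCA.
have e x y (z w v : R) : x * y * (z * w * v) = (x * z) * (y * w) * v by ring.
by rewrite !e aC (sgn_swap tu ts us) !mulNr.
Qed.

End Boundary.

Section Morse.

Local Open Scope ring_scope.
Variables (R : comNzRingType) (N : nat) (LT : eqType).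
Variables (lab : {set 'I_N} -> LT) (rho : {set 'I_N} -> nat).
Variable (piv : {set 'I_N} -> option 'I_N).
Implicit Types (s : {set 'I_N}) (t u w : 'I_N) (c : {set 'I_N} -> R).

(** With the lcm as label, these weights give the Taylor complex modulo the
    variables; with divisibility of [b] by the lcm as label, they give the part
    of the Taylor complex in the multidegree [b]. *)
Definition labw s t : R := (lab (t |: s) == lab s)%:R.

Hypothesis lab_convex : forall s t u,
  lab (u |: (t |: s)) = lab s -> lab (t |: s) = lab s.

(** A pivot is added to or removed from a simplex: this matches [s] with
    [w |: s]. *)
Hypothesis piv_toggle : forall s w, w \notin s ->
  piv s = Some w \/ piv (w |: s) = Some w ->
  [/\ lab (w |: s) = lab s, rho (w |: s) = rho s,
      piv s = Some w & piv (w |: s) = Some w].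

(** Passing to a face of the same label lowers the rank unless the pivot stays
    the same; so the matching is acyclic. *)
Hypothesis piv_mono : forall s t, t \notin s -> lab (t |: s) = lab s ->
  (rho s <= rho (t |: s))%N /\ (rho s = rho (t |: s) -> piv s = piv (t |: s)).

Definition cone c s : R :=
  if piv s is Some w then
    if w \in s then sgn R (s :\ w) w * c (s :\ w) else 0
  else 0.

Lemma piv_remove s w : w \in s -> piv s = Some w ->
  [/\ lab (s :\ w) = lab s, rho (s :\ w) = rho s & piv (s :\ w) = Some w].
Proof.
move=> ws pw; have ws' : w \notin s :\ w by rewrite setD11.
by have := piv_toggle ws'; rewrite setD1K // => /(_ (or_intror pw)) [-> ->].
Qed.

Lemma coneE c s w : piv s = Some w -> w \in s ->
  cone c s = sgn R (s :\ w) w * c (s :\ w).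
Proof. by rewrite /cone => -> ->. Qed.

(** At a simplex [s] of highest rank among those met by a cycle, the other terms
    of the homotopy formula cancel. *)
Lemma bd_cone c s w : piv s = Some w -> (forall s', bd labw c s' = 0) ->
  (forall s', (rho s < rho s')%N -> c s' = 0) -> bd labw (cone c) s = c s.
Proof.
move=> pw cyc high.
(* a nonzero term of [cone c] on a coface of [s] comes from the pivot of [s] *)
have coface t : t \notin s -> t != w -> lab (t |: s) = lab s ->
    cone c (t |: s) != 0 -> w \in s /\ piv (t |: s) = Some w.
  move=> ts tw labt; rewrite /cone; case pt: (piv (t |: s)) => [x|]; last first.
    by rewrite eqxx.
  case: ifP => [xts|_]; last by rewrite eqxx.
  have xt : x != t.
    apply: contraNneq tw => xt; subst x.
    have [|_ _ + _] := piv_toggle ts; first by right.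
    by rewrite pw => [[->]].
  have xs : x \in s by move: xts; rewrite !inE (negbTE xt).
  have [_ rx _] := piv_remove xts pt.
  have [rle req] := piv_mono ts labt.
  have [/high -> |] := ltnP (rho s) (rho ((t |: s) :\ x)); first by rewrite mulr0 eqxx.
  rewrite rx => rge _; have : rho s = rho (t |: s) by apply/eqP; rewrite eqn_leq rle.
  by move/req; rewrite pw pt => [[->]].
(* if [w] is not in [s], only the coface [w |: s] contributes *)
have [ws|ws] := boolP (w \in s); last first.
  have [lw _ _ pws] := piv_toggle ws (or_introl pw).
  rewrite /bd (bigD1 w) //= big1 ?addr0 => [|t /andP [ts tw]].
    rewrite (coneE _ pws) ?setU11 // setU1K // /labw lw eqxx mulr1 mulrA.
    by rewrite sgnK mul1r.
  have [labt|nlabt] := eqVneq (lab (t |: s)) (lab s); last first.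
    by rewrite /labw (negbTE nlabt) mulr0 mul0r.
  have [->|nz] := eqVneq (cone c (t |: s)) 0; first by rewrite mulr0.
  by have [] := coface t ts tw labt nz; rewrite (negbTE ws).
(* otherwise the cycle condition at [s :\ w] expresses [c s] by the values of [c]
   that occur in the cones *)
have [lw rw pr] := piv_remove ws pw.
set r := s :\ w in lw rw pr *.
have wr : w \notin r by rewrite setD11.
have sE : w |: r = s by rewrite setD1K.
have := cyc r; rewrite /bd (bigD1 w) //= sE => /eqP.
rewrite addr_eq0 => /eqP cw.
have -> : c s = - (sgn R r w * \sum_(t | (t \notin r) && (t != w))
    sgn R r t * labw r t * c (t |: r)).
  rewrite -mulrN -cw /labw sE lw eqxx mulr1 mulrA sgnK mul1r //.
rewrite mulr_sumr -sumrN; apply: eq_big => [t|t ts].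
  by rewrite -sE !inE negb_or andbC; congr (_ && _).
have tw : t != w by apply: contraNneq ts => ->.
have tr : t \notin r by rewrite inE (negbTE ts) andbF.
have tswE : (t |: s) :\ w = t |: r.
  apply/setP => x; rewrite !inE; case: (eqVneq x w) => [->|] //=.
  by rewrite eq_sym (negbTE tw).
have wts : w \in t |: s by rewrite inE ws orbT.
have [/andP [/eqP pt /eqP labt]|] :=
  boolP ((piv (t |: s) == Some w) && (lab (t |: s) == lab s)).
  have [lt _ _] := piv_remove wts pt; rewrite tswE in lt.
  rewrite (coneE _ pt wts) tswE /labw labt lt labt lw !eqxx !mulr1 !mulrA.
  rewrite -mulNr; congr (_ * _).
  have := sgn_swap R tw tr wr; rewrite sE => h.
  have -> : sgn R (t |: r) w = - (sgn R r t * (sgn R r w * sgn R s t)).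
    by rewrite -mulrN -h mulrA sgnK mul1r.
  rewrite mulrN; congr (- _).
  by rewrite [sgn R s t * _]mulrC -!mulrA sgnK mulr1 mulrC.
move=> nboth; rewrite -[sgn R s t * _ * _]mulrA.
have -> : labw s t * cone c (t |: s) = 0.
  rewrite /labw; case: (eqVneq (lab (t |: s)) (lab s)) => [labt|_]; last by rewrite mul0r.
  have [->|nz] := eqVneq (cone c (t |: s)) 0; first by rewrite mulr0.
  by have [_ pt] := coface t ts tw labt nz; move: nboth; rewrite pt labt !eqxx.
have [labt|nlabt] := eqVneq (lab (t |: r)) (lab r); last first.
  by rewrite /labw (negbTE nlabt) !(mulr0, mul0r, oppr0).
have [/high -> |rge] := ltnP (rho s) (rho (t |: r)); first by rewrite !mulr0 oppr0.
have [rle req] := piv_mono tr labt.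
have ptr : piv (t |: r) = Some w.
  by rewrite -req //; apply/eqP; rewrite eqn_leq rle rw rge.
have wtr : w \notin t |: r by rewrite -tswE setD11.
have wtrE : w |: (t |: r) = t |: s by rewrite -tswE setD1K.
have [] := piv_toggle wtr (or_introl ptr); rewrite wtrE => labs _ _ pts.
by move: nboth; rewrite pts labs labt lw !eqxx.
Qed.

(** Subtracting the boundaries of cones, rank by rank, exhausts a cycle whose
    simplices all have a pivot. *)
Lemma morse_acyclic (k : nat) (Q : pred LT) c :
    (forall s, c s != 0 -> #|s| = k /\ Q (lab s)) ->
    (forall s, #|s| = k -> Q (lab s) -> piv s != None) ->
    (forall s, bd labw c s = 0) ->
  exists2 c', forall s, c' s != 0 -> #|s| = k.+1 /\ Q (lab s)
            & forall s, c s = bd labw c' s.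
Proof.
move=> suppc pivk cyc.
pose top := (\max_s rho s).+1.
have : forall s, (top <= rho s)%N -> c s = 0.
  by move=> s; rewrite ltnNge (leq_bigmax s).
elim: top c suppc cyc => [|b IH] c suppc cyc low.
  exists (fun=> 0) => s; first by rewrite eqxx.
  by rewrite low // /bd big1 // => t _; rewrite mulr0.
have supp_cone s : cone c s != 0 -> #|s| = k.+1 /\ Q (lab s).
  rewrite /cone; case pw: (piv s) => [w|]; last by rewrite eqxx.
  case: ifP => [ws|_]; last by rewrite eqxx.
  have [lw _ _] := piv_remove ws pw.
  have [->|/suppc [sk Qs] _] := eqVneq (c (s :\ w)) 0; first by rewrite mulr0 eqxx.
  by rewrite (cardsD1 w) ws sk -lw.
have supp_bd s : bd labw (cone c) s != 0 -> #|s| = k /\ Q (lab s).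
  have [/andP [/eqP sk Qs] //|nP] := boolP ((#|s| == k) && Q (lab s)).
  rewrite /bd big1 ?eqxx // => t ts.
  rewrite /labw; case: eqP => [lt|_]; last by rewrite mulr0 mul0r.
  have [->|/supp_cone] := eqVneq (cone c (t |: s)) 0; first by rewrite mulr0.
  by rewrite cardsU1 ts lt => [[/eqP + Qs]]; rewrite eqSS => sk; rewrite sk Qs in nP.
pose c1 s := c s - bd labw (cone c) s.
have bdB f1 f2 s : bd labw (fun s => f1 s - f2 s) s = bd labw f1 s - bd labw f2 s.
  by rewrite /bd -sumrB; apply: eq_bigr => t _; rewrite mulrBr.
have [s| | |c2 supp2 c2E] := IH c1.
- have [bd0|/supp_bd //] := eqVneq (bd labw (cone c) s) 0.
  by rewrite /c1 bd0 subr0; apply: suppc.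
- move=> s; rewrite bdB cyc sub0r bd_bd ?oppr0 // => {}s t u.
  have labwM x y : labw s x * labw (x |: s) y = (lab (y |: (x |: s)) == lab s)%:R.
    rewrite /labw; have [->|nx] := eqVneq (lab (x |: s)) (lab s); first by rewrite mul1r.
    by rewrite mul0r; case: eqP => // /lab_convex e; rewrite e eqxx in nx.
  by rewrite !labwM setUCA.
- move=> s bs; rewrite /c1; apply/eqP; rewrite subr_eq0; apply/eqP/esym.
  have [/andP [/eqP sk Qs]|nP] := boolP ((#|s| == k) && Q (lab s)).
    have := pivk _ sk Qs; case pw: (piv s) => [w|] // _.
    by apply: bd_cone pw cyc _ => s' ss'; apply: low; apply: leq_ltn_trans ss'.
  have -> : c s = 0.
    by apply/eqP; apply: contraNT nP => /suppc [-> ->]; rewrite eqxx.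
  by apply/eqP; apply: contraNT nP => /supp_bd [-> ->]; rewrite eqxx.
exists (fun s => c2 s + cone c s) => s.
  have [c0|/supp2 //] := eqVneq (c2 s) 0; rewrite c0 add0r; exact: supp_cone.
rewrite -[c s](subrK (bd labw (cone c) s)) -/(c1 s) c2E /bd -big_split /=.
by apply: eq_bigr => t _; rewrite mulrDr.
Qed.

End Morse.

(** * The Taylor resolution *)

Section ChainMatrix.

Local Open Scope ring_scope.
Variables (R : comNzRingType) (N : nat).
Implicit Types (s : {set 'I_N}) (c : {set 'I_N} -> R) (k : nat).

Definition cells k : {set {set 'I_N}} := [set s : {set 'I_N} | #|s| == k].

Definition cell k (l : 'I_#|cells k|) : {set 'I_N} := enum_val l.

(** Rows become functions on all sets, so that the boundary matrices of all
    degrees are restrictions of the one map [bd]. *)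
Definition chain k (v : 'rV[R]_#|cells k|) s : R :=
  \sum_(l | cell l == s) v 0 l.

Definition bdmx (a : {set 'I_N} -> 'I_N -> R) k : 'M[R]_(#|cells k.+1|, #|cells k|) :=
  \matrix_(p, l) \sum_(t | (t \notin cell l) && (t |: cell l == cell p))
    sgn R (cell l) t * a (cell l) t.

Lemma card_cell k (l : 'I_#|cells k|) : #|cell l| = k.
Proof. by have := enum_valP l; rewrite inE => /eqP. Qed.

Lemma chain_val k (v : 'rV[R]_#|cells k|) l : chain v (cell l) = v 0 l.
Proof.
by rewrite /chain (big_pred1 l) // => p; rewrite /= (inj_eq enum_val_inj).
Qed.

Lemma chain_supp k (v : 'rV[R]_#|cells k|) s : chain v s != 0 -> #|s| = k.
Proof.
apply: contra_neq_eq => ns; rewrite /chain big_pred0 // => l.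
by apply: contra_neqF ns => /eqP <-; rewrite card_cell.
Qed.

Lemma chain_inj k (v w : 'rV[R]_#|cells k|) : chain v =1 chain w -> v = w.
Proof. by move=> vw; apply/rowP => l; rewrite -!chain_val vw. Qed.

Lemma chain_onto k c : (forall s, c s != 0 -> #|s| = k) ->
  exists v : 'rV[R]_#|cells k|, chain v =1 c.
Proof.
move=> suppc; exists (\row_l c (cell l)) => s.
have [sk|] := boolP (s \in cells k).
  by have <- : cell (enum_rank_in sk s) = s := enum_rankK_in sk sk; rewrite chain_val mxE.
rewrite inE => nk; have -> : c s = 0.
  by apply/eqP; apply: contraNT nk => /suppc ->.
by apply/eqP; apply: contraNT nk => /chain_supp ->.
Qed.

Lemma bd_supp a k c s : (forall s, c s != 0 -> #|s| = k.+1) ->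
  bd a c s != 0 -> #|s| = k.
Proof.
move=> suppc; apply: contra_neq_eq => nk; rewrite /bd big1 // => t ts.
have [->|/suppc] := eqVneq (c (t |: s)) 0; first by rewrite mulr0.
by rewrite cardsU1 ts => [[/eqP]]; rewrite (negbTE nk).
Qed.

Lemma eq_bd a c c' : c =1 c' -> bd a c =1 bd a c'.
Proof. by move=> cc' s; apply: eq_bigr => t _; rewrite cc'. Qed.

Lemma chain_mulmx a k (v : 'rV[R]_#|cells k.+1|) :
  chain (v *m bdmx a k) =1 bd a (chain v).
Proof.
move=> s; have [sk|nk] := boolP (s \in cells k); last first.
  have nk' : #|s| != k by move: nk; rewrite inE.
  transitivity (0 : R); first by apply/eqP; apply: contraNT nk' => /chain_supp ->.
  apply/esym/eqP; apply: contraNT nk'.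
  by move/(bd_supp (k := k)) => -> // s'; apply: chain_supp.
have <- : cell (enum_rank_in sk s) = s := enum_rankK_in sk sk.
rewrite chain_val; set l := enum_rank_in _ _.
rewrite mxE /bd.
under eq_bigr => p _ do rewrite mxE mulr_sumr.
rewrite (exchange_big_dep (fun t => t \notin cell l)) /=; last by move=> p t _ /andP [].
apply: eq_bigr => t tl; rewrite /chain mulr_sumr; apply: eq_big => p.
  by rewrite tl eq_sym.
by rewrite mulrC.
Qed.

End ChainMatrix.

Section Lcm.

Variables (N n : nat) (g : 'I_N -> 'X_{1..n}).
Implicit Types (s : {set 'I_N}) (t : 'I_N) (b : 'X_{1..n}).

Definition lcm_of s : 'X_{1..n} := [multinom \max_(t in s) g t i | i < n].

Lemma lcm_ofU1 s t i : lcm_of (t |: s) i = maxn (g t i) (lcm_of s i).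
Proof.
rewrite !mnmE; have [ts|ts] := boolP (t \in s); last by rewrite big_setU1.
have -> : t |: s = s by apply/setUidPr; rewrite sub1set.
by apply/esym/maxn_idPr; apply: leq_bigmax_cond.
Qed.

Lemma lcm_of_leP s b : (lcm_of s <= b)%MM <-> forall t, t \in s -> (g t <= b)%MM.
Proof.
split=> [/mnm_lepP sb t ts|sb].
  apply/mnm_lepP => i; apply: leq_trans (sb i); rewrite mnmE.
  exact: leq_bigmax_cond.
by apply/mnm_lepP => i; rewrite mnmE; apply/bigmax_leqP => t /sb /mnm_lepP.
Qed.

Lemma lcm_ofU1_le s t b :
  (lcm_of (t |: s) <= b)%MM = (g t <= b)%MM && (lcm_of s <= b)%MM.
Proof.
apply/idP/andP => [/lcm_of_leP sb|[tb /lcm_of_leP sb]].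
  by split; [|apply/lcm_of_leP => u us]; apply: sb; rewrite !inE ?eqxx ?us ?orbT.
by apply/lcm_of_leP => u /setU1P [->|/sb].
Qed.

Lemma lcm_of_sub s s' : s \subset s' -> (lcm_of s <= lcm_of s')%MM.
Proof.
move/subsetP => ss; apply/lcm_of_leP => t /ss ts.
by apply/mnm_lepP => i; rewrite mnmE; apply: leq_bigmax_cond.
Qed.

Lemma lcm_of_mem s t : t \in s -> (g t <= lcm_of s)%MM.
Proof. by move=> ts; apply: (lcm_of_leP s _).1 ts; apply: lepm_refl. Qed.

Lemma lcm_of1 t : lcm_of [set t] = g t.
Proof. by apply/mnmP => i; rewrite mnmE big_set1. Qed.

Lemma lcm_of0 : lcm_of set0 = 0%MM.
Proof. by apply/mnmP => i; rewrite !mnmE big_set0. Qed.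

Lemma lepm_anti m m' : (m <= m' -> m' <= m -> m = m' :> 'X_{1..n})%MM.
Proof.
move=> /mnm_lepP h /mnm_lepP h'; apply/mnmP => i.
by apply/eqP; rewrite eqn_leq h h'.
Qed.

End Lcm.

Section Taylor.

Local Open Scope ring_scope.
Variables (K : fieldType) (N n : nat) (g : 'I_N -> 'X_{1..n}).
Local Notation S := {mpoly K[n]}.
Implicit Types (s : {set 'I_N}) (t : 'I_N) (b m : 'X_{1..n}).

Local Notation lcm_of := (lcm_of g).

Definition taylor_weight s t : S := 'X_[(lcm_of (t |: s) - lcm_of s)%MM].

Lemma taylor_weightC s t u : taylor_weight s t * taylor_weight (t |: s) u =
  taylor_weight s u * taylor_weight (u |: s) t.
Proof.
have mul x y : taylor_weight s x * taylor_weight (x |: s) y =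
    'X_[(lcm_of (y |: (x |: s)) - lcm_of s)%MM].
  rewrite -mpolyXD; congr 'X_[_]; apply/mnmP => i; rewrite !mnmBE mnmDE !mnmBE.
  by rewrite !lcm_ofU1; lia.
by rewrite !mul setUCA.
Qed.

(** The part of the chain [c] in the multidegree [b]. *)
Definition strand b (c : {set 'I_N} -> S) s : K :=
  if (lcm_of s <= b)%MM then (c s)@_(b - lcm_of s)%MM else 0.

Lemma mcoeffXM q (p : S) m :
  ('X_[q] * p)@_m = if (q <= m)%MM then p@_(m - q)%MM else 0.
Proof.
case: ifP => [qm|nqm]; first by rewrite mulrC -{1}(submK qm) addmC mcoeffMX.
apply/eqP; rewrite mcoeff_eq0 mulrC (perm_mem (msuppMX _ _)).
by apply/mapP => [[m' _ e]]; rewrite e lem_addr in nqm.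
Qed.

Lemma sgn_scale s t (p : S) : sgn K s t *: p = sgn S s t * p.
Proof. by rewrite /sgn -signr_odd scaler_sign -[in RHS]signr_odd mulr_sign. Qed.

Lemma strand_bd b c s : bd taylor_weight c =1 (fun=> 0) ->
  bd (labw K (fun s => (lcm_of s <= b)%MM)) (strand b c) s = 0.
Proof.
move=> cyc; have [sb|nsb] := boolP (lcm_of s <= b)%MM; last first.
  rewrite /bd big1 // => t _; rewrite /strand lcm_ofU1_le (negbTE nsb) andbF.
  by rewrite mulr0.
transitivity ((bd taylor_weight c s)@_(b - lcm_of s)%MM); last first.
  by rewrite cyc mcoeff0.
rewrite /bd raddf_sum /=; apply: eq_bigr => t ts.
rewrite -!mulrA -sgn_scale mcoeffZ; congr (_ * _).
rewrite /taylor_weight mcoeffXM /labw /strand sb.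
have le_t : (lcm_of s <= lcm_of (t |: s))%MM by apply/lcm_of_sub/subsetUr.
have -> : (lcm_of (t |: s) - lcm_of s <= b - lcm_of s)%MM = (lcm_of (t |: s) <= b)%MM.
  apply/mnm_lepP/mnm_lepP => h i; move: (h i) (mnm_lepP sb i) (mnm_lepP le_t i);
  rewrite !mnmBE; lia.
case: ifP => _; last by rewrite mulr0.
rewrite eqxx mul1r; congr mcoeff; apply/mnmP => i.
have := mnm_lepP le_t i; rewrite !mnmBE.
by move: (b i) (lcm_of s i) (lcm_of (t |: s) i) => x y z; lia.
Qed.

(** In a fixed multidegree [b] the Taylor complex is the full simplex on the
    generators that divide [b], which is contracted to one of them. *)
Lemma strand_exact b c k : (forall s, c s != 0 -> #|s| = k.+1) ->
    bd taylor_weight c =1 (fun=> 0) ->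
  exists2 w : {set 'I_N} -> K,
    forall s, w s != 0 -> #|s| = k.+2 /\ (lcm_of s <= b)%MM &
    forall s, strand b c s = bd (labw K (fun s => (lcm_of s <= b)%MM)) w s.
Proof.
move=> suppc cyc.
pose piv s := if (lcm_of s <= b)%MM then [pick t | (g t <= b)%MM] else None.
apply: (@morse_acyclic K N bool _ (fun=> 0%N) piv _ _ _ k.+1 id) => //.
- move=> s t u; rewrite !lcm_ofU1_le; case: (lcm_of s <= b)%MM; rewrite ?andbF //.
  by case: (g t <= b)%MM; rewrite // andbF.
- move=> s w ws; rewrite /piv lcm_ofU1_le; case: pickP => [t tb|_].
    by case: (lcm_of s <= b)%MM; rewrite ?andbF => -[] //;
       rewrite ?andbT; [move=> [<-]|case: ifP => // + [<-]]; rewrite tb.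
  by case: ifP; case: ifP => _ _ [].
- by move=> s t _ e; split=> // _; rewrite /piv e.
- move=> s; rewrite /strand; case: ifP => [sb|_]; last by rewrite eqxx.
  by have [->|/suppc] := eqVneq (c s) 0; first by rewrite mcoeff0 eqxx.
- move=> s sk sb; rewrite /piv sb; case: pickP => // nob.
  have /card_gt0P [t ts] : (0 < #|s|)%N by rewrite sk.
  by have := nob t; rewrite (lepm_trans (lcm_of_mem g ts) sb).
by move=> s; apply: strand_bd.
Qed.

Lemma taylor_exact c k : (forall s, c s != 0 -> #|s| = k.+1) ->
    bd taylor_weight c =1 (fun=> 0) ->
  exists2 w : {set 'I_N} -> S, forall s, w s != 0 -> #|s| = k.+2
                             & c =1 bd taylor_weight w.
Proof.
move=> suppc cyc.
have ex_w b : exists w : {set 'I_N} -> K,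
    (forall s, w s != 0 -> #|s| = k.+2 /\ (lcm_of s <= b)%MM) /\
    (forall s, strand b c s = bd (labw K (fun s => (lcm_of s <= b)%MM)) w s).
  by have [w] := strand_exact b suppc cyc; exists w.
pose w b := proj1_sig (constructive_indefinite_description _ (ex_w b)).
have wP b := proj2_sig (constructive_indefinite_description _ (ex_w b)).
have suppw b s : w b s != 0 -> #|s| = k.+2 /\ (lcm_of s <= b)%MM.
  by case: (wP b) => + _; apply.
have strandE b s : strand b c s = bd (labw K (fun s => (lcm_of s <= b)%MM)) (w b) s.
  by case: (wP b).
pose bs := undup [seq (m + lcm_of s)%MM | s <- enum {set 'I_N}, m <- msupp (c s)].
(* a chain is the sum of its strands *)
have cE s : c s = \sum_(b <- bs) strand b c s *: 'X_[(b - lcm_of s)%MM].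
  apply/mpolyP => m; rewrite raddf_sum /=.
  under eq_bigr => b _ do rewrite mcoeffZ mcoeffX.
  have [m0|m1] := eqVneq (c s)@_m 0.
    rewrite m0 big1 // => b _; rewrite /strand; case: ifP => sb; last by rewrite mul0r.
    by case: eqP => [->|_]; rewrite ?m0 ?mul0r ?mulr0.
  rewrite (bigD1_seq (m + lcm_of s)%MM) /=; last exact: undup_uniq; last first.
    rewrite mem_undup; apply/allpairsPdep; exists s, m.
    by rewrite mem_enum mcoeff_msupp.
  rewrite /strand lem_addl addmK eqxx mulr1 big1 ?addr0 // => b nb.
  case: ifP => sb; last by rewrite mul0r.
  case: eqP => [e|_]; last by rewrite mulr0.
  by rewrite -e submK ?eqxx in nb.
exists (fun s => \sum_(b <- bs) w b s *: 'X_[(b - lcm_of s)%MM]) => [s|s].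
  move=> nz; apply/eqP; apply: contraNT nz => nk; rewrite big1 // => b _.
  have [->|/suppw [e _]] := eqVneq (w b s) 0; first by rewrite scale0r.
  by rewrite e eqxx in nk.
rewrite cE /bd; under eq_bigr => b _ do rewrite strandE /bd scaler_suml.
rewrite exchange_big /=; apply: eq_bigr => t ts; rewrite mulr_sumr.
apply: eq_bigr => b _; rewrite -!mulrA -scalerA sgn_scale; congr (_ * _).
have [->|/suppw [_ tsb]] := eqVneq (w b (t |: s)) 0.
  by rewrite mulr0 !scale0r mulr0.
have := tsb; rewrite lcm_ofU1_le => /andP [_ sb].
rewrite /labw tsb sb eqxx mul1r -scalerAr -mpolyXD; congr (_ *: 'X_[_]).
apply/mnmP => i; have := mnm_lepP tsb i.
have := mnm_lepP (lcm_of_sub g (subsetUr [set t] s)) i; rewrite mnmDE !mnmBE.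
by move: (b i) (lcm_of s i) (lcm_of (t |: s) i) => x y z; lia.
Qed.

Definition taylor_aug : 'cV[S]_#|cells N 1| := \col_k 'X_[lcm_of (cell k)].

Lemma taylor_diff_homog i k l : bdmx taylor_weight i.+1 k l != 0 ->
  exists2 e, mdeg (lcm_of (cell k)) = (mdeg (lcm_of (cell l)) + e)%N &
    bdmx taylor_weight i.+1 k l \is e.-homog.
Proof.
rewrite mxE => nz.
have [t /andP [tl /eqP tk]] :
    exists t, (t \notin cell l) && (t |: cell l == cell k).
  by apply/existsP; apply: contraNT nz => /existsPn h; rewrite big_pred0 // => t;
     apply/negbTE.
have lk : (lcm_of (cell l) <= lcm_of (cell k))%MM.
  by apply: lcm_of_sub; rewrite -tk subsetUr.
exists (mdeg (lcm_of (cell k) - lcm_of (cell l))).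
  by rewrite -mdegD addmC submK.
apply: rpred_sum => u /andP [_ /eqP uk]; rewrite /taylor_weight uk.
by rewrite -sgn_scale rpredZ // dhomogX.
Qed.

Lemma taylor_aug_homog k : taylor_aug k 0 \is (mdeg (lcm_of (cell k))).-homog.
Proof. by rewrite mxE dhomogX. Qed.

(** With the empty set as the basis of its first module the Taylor complex resolves
    the quotient by the ideal; a resolution of the ideal itself starts at the
    singletons, so that simplices with [i + 1] elements are in degree [i]. *)
Definition taylor : graded_free K n :=
  @GradedFree K n (fun i => #|cells N i.+1|) (fun i k => mdeg (lcm_of (cell k)))
    (fun i => bdmx taylor_weight i.+1) taylor_aug
    taylor_diff_homog taylor_aug_homog.

Lemma mul_taylor_aug (v : 'rV[S]_#|cells N 1|) :
  v *m taylor_aug = (bd taylor_weight (chain v) set0)%:M.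
Proof.
apply/matrixP => i j; rewrite !ord1 !mxE eqxx mulr1n /bd.
under [RHS]eq_bigr => t _ do
  rewrite sgn0 mul1r setU0 /taylor_weight setU0 lcm_of0 subm0 mulr_sumr.
rewrite (exchange_big_dep xpredT) //=; apply: eq_bigr => k _.
have /eqP/cards1P [t kt] := card_cell k.
rewrite mxE kt (big_pred1 t) => [|u]; first exact: mulrC.
by rewrite in_set0 /= (inj_eq set1_inj) eq_sym.
Qed.

Lemma taylor_resolves (L : S -> Prop) :
    (forall f, L f <-> (forall m, m \in msupp f -> exists t, (g t <= m)%MM)) ->
  resolves taylor L.
Proof.
move=> LE.
have cycle_im k (v : 'rV[S]_#|cells N k.+1|) : bd taylor_weight (chain v) =1 (fun=> 0) <->
    exists w, v = w *m bdmx taylor_weight k.+1.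
  split=> [cyc|[w ->] s]; last first.
    by rewrite (eq_bd _ (chain_mulmx _ w)) bd_bd //; apply: taylor_weightC.
  have [c suppc vE] := taylor_exact (@chain_supp _ _ _ v) cyc.
  have [w wE] := chain_onto suppc; exists w; apply: chain_inj => s.
  by rewrite chain_mulmx vE; apply: eq_bd.
have bd_set0 k (v : 'rV[S]_#|cells N k.+1|) :
    bd taylor_weight (chain v) =1 (fun=> 0) <-> 
    forall s, #|s| = k -> bd taylor_weight (chain v) s = 0.
  split=> [cyc s _|cyc s]; first exact: cyc.
  have [//|nz] := eqVneq (bd taylor_weight (chain v) s) 0.
  by apply/cyc/(bd_supp _ nz) => s'; apply: chain_supp.
split.
- move=> f; rewrite LE; split=> [Lf|[v /matrixP /(_ 0 0)]]; last first.
    rewrite !mxE eqxx mulr1n => <- m /msupp_sum_le /flattenP [? /mapP [k _ ->]].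
    rewrite mxE.
    apply: (msuppM_up (P := fun m => exists t, (g t <= m)%MM)) => [m1 m2 m12 [t tm]|m'].
      by exists t; apply: lepm_trans m12.
    have /eqP/cards1P [t ->] := card_cell k.
    by rewrite msuppX inE lcm_of1 => /eqP ->; exists t; apply: lepm_refl.
  rewrite [f]mpolyE; elim: (msupp f) Lf => [|m r IH] Lf.
    by exists 0; rewrite big_nil mul0mx raddf0.
  have [|v vE] := IH; first by move=> m' rm'; apply: Lf; rewrite inE rm' orbT.
  have [t tm] := Lf m (mem_head _ _).
  have ct : [set t] \in cells N 1 by rewrite inE cards1.
  have kt : cell (enum_rank_in ct [set t]) = [set t] := enum_rankK_in ct ct.
  exists ((f@_m *: 'X_[(m - g t)%MM]) *: delta_mx 0 (enum_rank_in ct [set t]) + v).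
  rewrite big_cons mulmxDl vE raddfD /= -scalemxAl -rowE; congr (_ + _).
  apply/matrixP => i j; rewrite !ord1 !mxE eqxx mulr1n kt lcm_of1.
  by rewrite -scalerAl -mpolyXD submK.
- move=> v; rewrite -cycle_im bd_set0 /= mul_taylor_aug; split=> [e s /eqP|e].
    rewrite cards_eq0 => /eqP ->; move/matrixP/(_ 0 0): e.
    by rewrite !mxE eqxx mulr1n.
  by rewrite e ?cards0 // raddf0.
move=> i v; rewrite -cycle_im; split=> [e s|cyc].
  by rewrite -chain_mulmx /= e /chain big1 // => l _; rewrite mxE.
apply: chain_inj => s; rewrite chain_mulmx cyc /chain big1 // => l _.
by rewrite mxE.
Qed.

End Taylor.

(** * Linear quotients give a linear resolution *)

Section Pivot.

Variables (N n : nat) (g : 'I_N -> 'X_{1..n}).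
Implicit Types (s : {set 'I_N}) (t u v w : 'I_N) (i j : 'I_n).

Local Notation lcm_of := (lcm_of g).

(** [g w] generates the variable [j] in the colon ideal of the predecessors of
    [v] by [g v]. *)
Definition hits w v j : bool :=
  [&& w < v, g w j == (g v j).+1 & [forall i, (i != j) ==> (g w i <= g v i)]].

Definition witness v j : option 'I_N := [pick w | hits w v j].

(** One more than the index of the last element, so that 0 is left for the empty
    set. *)
Definition height s : nat := \max_(t in s) t.+1.

(** Relative to the apex [v], the last element of [s], the candidates for a pivot
    are the chosen witnesses of the variables of the colon ideal at [v].  Such a
    witness is free if neither adding nor removing it affects the lcm. *)
Definition free_witness s w : bool := [exists v in s, [exists j,
  [&& v.+1 == height s, witness v j == Some w, (g w <= lcm_of s)%MM
    & lcm_of (s :\ w) == lcm_of s]]].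

Definition pivot s : option 'I_N :=
  [pick w | free_witness s w && [forall u, free_witness s u ==> (w <= u)]].

(** Lexicographic: the rank drops when the apex is lost and, for a fixed apex, when
    the pivot moves up or disappears. *)
Definition pivot_rank s : nat :=
  height s * N.+1 + (N - (if pivot s is Some w then w : nat else N)).

Lemma witnessP v j w : witness v j = Some w ->
  [/\ w < v, g w j = (g v j).+1 & forall i, i != j -> g w i <= g v i].
Proof.
rewrite /witness; case: pickP => // w' /and3P [wv /eqP wj /forallP h] [<-].
by split=> // i /(implyP (h i)).
Qed.

Lemma witness_inj v i j w : witness v i = Some w -> witness v j = Some w -> i = j.
Proof.
move=> /witnessP [_ wi _] /witnessP [_ _ wj]; have [//|ij] := eqVneq i j.
by have := wj i ij; rewrite wi ltnn.
Qed.

Lemma free_witnessP s w : reflect (exists v j, [/\ v \in s, v.+1 = height s,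
    witness v j = Some w, (g w <= lcm_of s)%MM & lcm_of (s :\ w) = lcm_of s])
  (free_witness s w).
Proof.
apply: (iffP exists_inP) => [[v vs /existsP [j /and4P [/eqP ? /eqP ? ? /eqP ?]]]|].
  by exists v, j.
move=> [v [j [vs h1 h2 h3 h4]]]; exists v => //; apply/existsP; exists j.
by rewrite h1 h2 h3 h4 !eqxx.
Qed.

Lemma pivot_some s w :
  pivot s = Some w <-> free_witness s w /\ forall u, free_witness s u -> w <= u.
Proof.
rewrite /pivot; split=> [|[fw minw]].
  case: pickP => // w' /andP [fw /forallP minw] [<-].
  by split=> // u /(implyP (minw u)).
case: pickP => [w' /andP [fw' /forallP minw']|/(_ w)].
  congr Some; apply/val_inj/eqP; rewrite eqn_leq minw // andbT.
  by have /implyP -> := minw' w.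
by rewrite fw /= => /negbT/negP []; apply/forallP => u; apply/implyP/minw.
Qed.

Lemma pivot_none s : pivot s = None -> forall w, free_witness s w = false.
Proof.
move=> ps w; case fw: (free_witness s w) => //.
case: (@arg_minnP _ w (free_witness s) val fw) => u fu minu.
by have : pivot s = Some u by [apply/pivot_some]; rewrite ps.
Qed.

Lemma height_le s s' : s \subset s' -> height s <= height s'.
Proof.
by move/subsetP => ss; apply/bigmax_leqP => t /ss ts; apply: leq_bigmax_cond.
Qed.

Lemma height_mem s t : t \in s -> t < height s.
Proof. by move=> ts; apply: (@leq_bigmax_cond _ (mem s) (fun u : 'I_N => u.+1)). Qed.

Lemma lcm_of_eq s s' : s \subset s' -> (lcm_of s' <= lcm_of s)%MM ->
  lcm_of s' = lcm_of s.
Proof. by move=> ss le; apply: lepm_anti le _; apply: lcm_of_sub. Qed.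

(** The lcm of [s' :\ w] lies between those of [s :\ w] and [s'], which are
    equal. *)
Lemma free_witness_mono s s' w : s \subset s' -> lcm_of s' = lcm_of s ->
  height s' = height s -> free_witness s w -> free_witness s' w.
Proof.
move=> ss el eh /free_witnessP [v [j [vs vh vw wl wf]]]; apply/free_witnessP; exists v, j.
split; rewrite ?eh ?el //; first exact: (subsetP ss).
rewrite -el; apply/esym/lcm_of_eq; first exact: subD1set.
by rewrite el -wf lcm_of_sub // setSD.
Qed.

Lemma pivot_mono s t : t \notin s -> lcm_of (t |: s) = lcm_of s ->
  pivot_rank s <= pivot_rank (t |: s) /\
  (pivot_rank s = pivot_rank (t |: s) -> pivot s = pivot (t |: s)).
Proof.
move=> ts el; have sub : s \subset t |: s by apply: subsetUr.
have := height_le sub; rewrite leq_eqVlt => /orP [/eqP eh|lth]; last first.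
  suff lt : pivot_rank s < pivot_rank (t |: s).
    by split=> [|e]; [apply: ltnW | rewrite e ltnn in lt].
  rewrite /pivot_rank; apply: (@leq_trans ((height s).+1 * N.+1)).
    by rewrite mulSnr -ltn_subRL addKn ltnS leq_subr.
  by apply: leq_trans (leq_addr _ _); rewrite leq_mul2r lth orbT.
have mono w : free_witness s w -> free_witness (t |: s) w by apply: free_witness_mono.
rewrite /pivot_rank -eh leq_add2l; case ps: (pivot s) => [w|]; last first.
  rewrite subnn; split=> // /eqP; rewrite eqn_add2l eq_sym subn_eq0.
  by case: (pivot (t |: s)) => // w; rewrite leqNgt ltn_ord.
have /pivot_some [fw _] := ps.
case pt: (pivot (t |: s)) => [u|]; last by have := pivot_none pt w; rewrite mono.
have /pivot_some [fu minu] := pt.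
split; first by apply/leq_sub2l/minu/mono.
move/eqP; rewrite eqn_add2l => /eqP e; congr Some; apply/val_inj.
by move: e (ltn_ord w) (ltn_ord u) => /=; lia.
Qed.

Lemma pivot_toggle s w : w \notin s ->
    pivot s = Some w \/ pivot (w |: s) = Some w ->
  [/\ lcm_of (w |: s) = lcm_of s, pivot_rank (w |: s) = pivot_rank s,
      pivot s = Some w & pivot (w |: s) = Some w].
Proof.
move=> ws pw; have sub : s \subset w |: s by apply: subsetUr.
have [el eh fs fws] : [/\ lcm_of (w |: s) = lcm_of s, height (w |: s) = height s,
    free_witness s w & free_witness (w |: s) w].
  have heightU v : v \in s -> w < v -> height (w |: s) = height s.
    move=> vs wv; rewrite /height big_setU1 //=; apply/maxn_idPr.
    by apply: leq_trans (height_mem vs); apply: ltnW.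
  have sDw : s :\ w = s by apply/setDidPl; rewrite disjoint_sym disjoints1.
  case: pw => /pivot_some [fw _]; have := fw => /free_witnessP [v [j [vs vh vw wl wf]]];
    have [wv _ _] := witnessP vw.
    have el : lcm_of (w |: s) = lcm_of s.
      by apply: lcm_of_eq => //; rewrite lcm_ofU1_le wl lepm_refl.
    have eh := heightU v vs wv; split=> //; exact: (free_witness_mono sub el eh).
  have {}vs : v \in s.
    by move: vs; rewrite !inE => /orP [/eqP vw'|//]; rewrite vw' ltnn in wv.
  have el : lcm_of (w |: s) = lcm_of s by rewrite -wf setU1K.
  have eh := heightU v vs wv; split=> //; apply/free_witnessP; exists v, j.
  by rewrite -eh -el sDw -el.
(* a smaller free witness of [w |: s] belongs to another variable, so that [w]
   does not contribute to its exponent *)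
have free_witness_sub u : free_witness (w |: s) u -> u != w -> free_witness s u.
  move=> /free_witnessP [v [j [vs vh vu ul uf]]] uw.
  have /free_witnessP [v' [j' [v's v'h v'w wl _]]] := fs.
  have ev : v' = v by apply/val_inj/eqP; rewrite -eqSS vh v'h eh.
  have vsu : v \in s :\ u.
    have [uv _ _] := witnessP vu.
    by rewrite !inE -ev v's andbT ev; apply: contraTneq uv => ->; rewrite ltnn.
  have [_ _ wle] := witnessP v'w; have [_ _ ule] := witnessP vu.
  have nj : j != j'.
    by apply: contraNneq uw => jj; move: v'w; rewrite ev -jj vu => -[->].
  apply/free_witnessP; exists v, j; split; rewrite -?eh -?el //.
    by move: vsu; rewrite !inE => /andP [].
  rewrite -uf; apply/mnmP => i.
  have -> : (w |: s) :\ u = w |: s :\ u.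
    by rewrite setDUl; congr (_ :|: _); apply/setDidPl; rewrite disjoints1 inE eq_sym.
  have vi : g v i <= lcm_of (s :\ u) i by apply/mnm_lepP/lcm_of_mem.
  have [ij|ij] := eqVneq i j'; last first.
    by rewrite lcm_ofU1; apply/esym/maxn_idPr/(leq_trans _ vi); rewrite -ev wle.
  have -> : lcm_of (w |: s :\ u) i = lcm_of s i.
    rewrite -el -uf; congr (lcm_of _ i).
    by rewrite setDUl; congr (_ :|: _); apply/esym/setDidPl; rewrite disjoints1 inE eq_sym.
  have [us|us] := boolP (u \in s); last first.
    by congr (lcm_of _ i); apply/setDidPl; rewrite disjoint_sym disjoints1.
  rewrite -[in RHS](setD1K us) lcm_ofU1; apply/esym/maxn_idPr/(leq_trans _ vi).
  by apply: ule; rewrite ij eq_sym.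
have both : pivot s = Some w /\ pivot (w |: s) = Some w.
  rewrite !pivot_some; case: pw => /pivot_some [_ minw].
    split=> //; split=> // u fu; have [-> //|uw] := eqVneq u w.
    by apply/minw/free_witness_sub.
  by split=> //; split=> // u /(free_witness_mono sub el eh) /minw.
by case: both => ps pws; split; rewrite // /pivot_rank eh ps pws.
Qed.

(** This is what linear quotients give: the contribution of [t] to the colon
    ideal at [v] is divisible by one of the variables that generate it. *)
Hypothesis linear : forall t v, t < v -> exists w j, hits w v j /\ g v j < g t j.

(** Without a free witness, each element other than the apex is the only one
    that contributes its variable to the lcm. *)
Lemma critical_degree s : s != set0 -> pivot s = None -> 
  exists2 v, v \in s & mdeg (lcm_of s) = mdeg (g v) + #|s|.-1.
Proof.
move=> /set0Pn [t0 t0s] ps; have nofree := pivot_none ps.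
case: (@arg_maxnP _ t0 (mem s) val t0s) => v vs maxv; rewrite /= in vs maxv.
have vh : v.+1 = height s.
  apply/eqP; rewrite eqn_leq height_mem //=; apply/bigmax_leqP => t ts.
  exact: maxv.
exists v => //; set r := s :\ v.
have rlt t : t \in r -> t < v.
  rewrite !inE => /andP [tv ts]; rewrite ltn_neqAle maxv // andbT.
  by apply: contraNneq tv => /val_inj ->.
have vr t : t \in r -> v \in s :\ t.
  by move/rlt => tv; rewrite !inE vs andbT; apply: contraTneq tv => ->; rewrite ltnn.
have wit t : t \in r -> exists j, witness v j = Some t.
  move=> tr; have ts : t \in s by move: tr; rewrite inE => /andP [].
  have [w0 [j [w0j tj]]] := linear (rlt t tr).
  case vw: (witness v j) => [w|]; last first.
    by move: vw; rewrite /witness; case: pickP => // /(_ w0); rewrite w0j.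
  exists j; rewrite vw; congr Some; apply/eqP/negPn/negP => wt.
  have [wv wj wle] := witnessP vw.
  have gw_le (s' : {set 'I_N}) : t \in s' -> v \in s' -> (g w <= lcm_of s')%MM.
    move=> ts' vs'; apply/mnm_lepP => i; have [->|ij] := eqVneq i j.
      by rewrite wj; apply: leq_trans tj _; apply/mnm_lepP/lcm_of_mem.
    by apply: leq_trans (wle i ij) _; apply/mnm_lepP/lcm_of_mem.
  have /negP [] := negbT (nofree w); apply/free_witnessP; exists v, j; split=> //.
    exact: gw_le.
  have [ws|ws] := boolP (w \in s); last first.
    by congr lcm_of; apply/setDidPl; rewrite disjoint_sym disjoints1.
  apply/esym/lcm_of_eq; first exact: subD1set.
  rewrite -{1}(setD1K ws) lcm_ofU1_le lepm_refl andbT; apply: gw_le.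
    by rewrite !inE eq_sym wt.
  by rewrite !inE vs andbT; apply: contraTneq wv => ->; rewrite ltnn.
have lcmE i : lcm_of s i = g v i + \sum_(t in r) (witness v i == Some t).
  have sE : s = v |: r by rewrite setD1K.
  case vi: (witness v i) => [t|]; last first.
    rewrite big1 // addn0 sE lcm_ofU1; apply/maxn_idPl; rewrite mnmE.
    apply/bigmax_leqP => t /wit [j vj]; have [_ _ -> //] := witnessP vj.
    by apply: contra_eq_neq vi => ->; rewrite vj.
  have [tv ti _] := witnessP vi.
  have other u : u \in r -> u != t -> g u i <= g v i.
    move=> /wit [j vj] ut; have [_ _ -> //] := witnessP vj.
    by apply: contra_neq ut => ij; move: vi; rewrite ij vj => -[].
  have [tr|tr] := boolP (t \in r).
    rewrite (bigD1 t) //= eqxx big1 => [|u /andP [_ ut]]; last first.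
      by rewrite (inj_eq Some_inj) eq_sym (negbTE ut).
    rewrite sE lcm_ofU1 addn0 addn1 -ti -(setD1K tr) lcm_ofU1.
    have le : lcm_of (r :\ t) i <= g v i.
      by rewrite mnmE; apply/bigmax_leqP => u /setD1P [ut ur]; apply: other.
    by rewrite ti; move: (g v i) (lcm_of (r :\ t) i) le => x y; lia.
  rewrite big1 => [|u ur]; last first.
    by apply/eqP; rewrite eqb0 (inj_eq Some_inj); apply: contraNneq tr => ->.
  rewrite addn0 sE lcm_ofU1; apply/maxn_idPl; rewrite mnmE.
  apply/bigmax_leqP => u ur; apply: other => //.
  by apply: contraNneq tr => <-.
rewrite mdegE (eq_bigr _ (fun i _ => lcmE i)) big_split /= -mdegE; congr (_ + _).
rewrite exchange_big /= -[in RHS](setD1K vs) cardsU1 !inE eqxx /= -sum1_card.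
apply: eq_bigr => t /wit [j vj]; rewrite (bigD1 j) //= vj eqxx big1 // => i ij.
by apply/eqP; rewrite eqb0; apply: contra ij => /eqP vi; rewrite (witness_inj vi vj).
Qed.

End Pivot.

Section LinearResolution.

Local Open Scope ring_scope.
Variables (K : fieldType) (n : nat).
Local Notation S := {mpoly K[n]}.
Variables (L : S -> Prop).

Lemma taylor_homology (N : nat) (g : 'I_N -> 'X_{1..n}) d i j :
    (forall t, mdeg (g t) = d) ->
    (forall t v : 'I_N, (t < v)%N -> exists w j, hits g w v j /\ (g v j < g t j)%N) ->
    j != (i + d)%N ->
  homology_eq0 (taylor K g) i j.
Proof.
move=> gd linear ij v vj vcyc.
have kdiffE k : kdiff (taylor K g) k = bdmx (labw K (lcm_of g)) k.+1.
  apply/matrixP => p l; rewrite !mxE rmorph_sum /=; apply: eq_bigr => t /andP [tl _].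
  rewrite -sgn_scale mcoeffZ /taylor_weight mcoeffX /labw; congr (_ * (_ : bool)%:R).
  have le : (lcm_of g (cell l) <= lcm_of g (t |: cell l))%MM.
    by apply/lcm_of_sub/subsetUr.
  apply/eqP/eqP => [e|->]; last by apply/mnmP => x; rewrite mnmBE subnn mnm0E.
  by rewrite -(submK le) e add0m.
have suppv s : chain v s != 0 -> #|s| = i.+1 /\ mdeg (lcm_of g s) == j.
  move=> nz; have sk := chain_supp nz; split=> //.
  have sc : s \in cells N i.+1 by rewrite inE sk.
  have sE : cell (enum_rank_in sc s) = s := enum_rankK_in sc sc.
  apply: contraNT nz => nj; have := vj (enum_rank_in sc s).
  by rewrite -chain_val /= sE => ->.
have cyc s : bd (labw K (lcm_of g)) (chain v) s = 0.
  (* all chains are cycles for [i = 0], but the generators have degree [d] *)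
  case: i ij v vj vcyc suppv => [|i] ij v vj vcyc suppv.
    rewrite /bd big1 // => t _.
    have [->|] := eqVneq (chain v (t |: s)) 0; first by rewrite mulr0.
    move=> /suppv [/eqP/cards1P [u ->]].
    by rewrite lcm_of1 gd => /eqP dj; rewrite -dj eqxx in ij.
  move: vcyc; rewrite /= kdiffE => vcyc.
  by rewrite -chain_mulmx vcyc /chain big1 // => l _; rewrite mxE.
have convex (s : {set 'I_N}) t u :
    lcm_of g (u |: (t |: s)) = lcm_of g s -> lcm_of g (t |: s) = lcm_of g s.
  move=> e; apply: lcm_of_eq; first exact: subsetUr.
  by rewrite -e lcm_of_sub // subsetUr.
have crit (s : {set 'I_N}) : #|s| = i.+1 -> mdeg (lcm_of g s) == j -> pivot g s != None.
  move=> sk /eqP sj; apply: contraNneq ij => ps.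
  have [|v' _] := critical_degree linear _ ps; first by rewrite -card_gt0 sk.
  by rewrite sj sk gd addnC => ->.
have [c suppc vE] := morse_acyclic (Q := fun m => mdeg m == j) convex (@pivot_toggle _ _ g) (@pivot_mono _ _ g)
  suppv crit cyc.
have [w wE] := chain_onto (fun s nz => proj1 (suppc s nz)).
exists w => [l lj|].
  have [//|nz] := eqVneq (w 0 l) 0.
  move: nz; rewrite -chain_val wE => /suppc [_ /eqP e].
  by rewrite /= e eqxx in lj.
apply: chain_inj => s; rewrite kdiffE chain_mulmx vE; apply: eq_bd => s'.
by rewrite wE.
Qed.

Lemma linear_quotients_linear_resolution (s : seq 'X_{1..n}) :
    monomial_ideal L -> single_degree L -> linear_quotients L s ->
  linear_resolution L.
Proof.
move=> monL sdL [us mems colonL].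
pose g (t : 'I_(size s)) := nth 0%MM s t.
have gs t : g t \in s by apply: mem_nth.
have linear (t v : 'I_(size s)) : (t < v)%N ->
    exists w j, hits g w v j /\ (g v j < g t j)%N.
  move=> tv; have v0 : (0 < v < size s)%N by rewrite (leq_ltn_trans _ tv) /=.
  have [A AE] := colonL v v0.
  have take_v (u : 'I_(size s)) : (u < v)%N -> g u \in take v s.
    by move=> uv; rewrite in_take ?gs // index_uniq.
  have [j Aj tj] : exists2 j, j \in A & (0 < (g t - g v)%MM j)%N.
    have /var_idealP : var_ideal A ('X_[(g t - g v)%MM] : S).
      apply/AE/colon_mon_idealP => m; rewrite msuppX inE => /eqP ->.
      exists (g t); first exact: take_v.
      by apply/mnm_lepP => i; rewrite mnmDE mnmBE; move: (g t i) (g v i) => x y; lia.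
    by apply; rewrite msuppX inE.
  have [a /[dup] /mem_take sa av aj] : exists2 a, a \in take v s & (a <= U_(j) + g v)%MM.
    have /AE/colon_mon_idealP : var_ideal A ('X_j : S).
      by apply: ideal_gen_gen; exists j.
    by apply; rewrite msuppX inE.
  have iv : (index a s < v)%N by move: av; rewrite in_take.
  have isz : (index a s < size s)%N by rewrite index_mem.
  exists (Ordinal isz), j; split; last by move: tj; rewrite mnmBE subn_gt0.
  have ga : g (Ordinal isz) = a by rewrite /g /= nth_index.
  rewrite /hits /= iv ga /=.
  have le i : i != j -> (a i <= g v i)%N.
    move=> ij; move/mnm_lepP/(_ i): aj.
    by rewrite mnmDE mnm1E eq_sym (negbTE ij).
  apply/andP; split; last by apply/forallP => i; apply/implyP/le.
  rewrite eqn_leq; apply/andP; split.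
    by move/mnm_lepP/(_ j): aj; rewrite mnmDE mnm1E eqxx.
  rewrite ltnNge; apply/negP => aj'.
  have ag : a = g v.
    have [_ ming] := (mems (g v)).1 (gs v); apply: ming; first by case: ((mems a).1 sa).
    by apply/mnm_lepP => i; have [->|/le] := eqVneq i j.
  by move: iv; rewrite ag index_uniq // ltnn.
exists (mdeg (nth 0%MM s 0)) => i j ij; exists (taylor K g).
  apply: taylor_resolves => f; rewrite (monomial_ideal_mingenP monL).
  split=> Lf m /Lf => [[u /mems us' um]|[t tm]]; last by exists (g t) => //; apply/mems.
  have isz : (index u s < size s)%N by rewrite index_mem.
  by exists (Ordinal isz); rewrite /g /= nth_index.
apply: (taylor_homology _ linear ij) => t; apply: sdL; apply/mems => //.
by apply: mem_nth; apply: leq_ltn_trans (ltn_ord t).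
Qed.

(** A minimal generator of degree [j] is a combination of the augmented basis
    elements in which only constant coefficients in degree [j] matter; a
    boundary modulo the maximal ideal contributes nothing to its coefficient. *)
Lemma Tor0_mingen_degree m j : monomial_ideal L -> mingen L m -> Tor_eq0 L 0 j ->
  mdeg m != j.
Proof.
move=> monL [Lm minm] [F [augE exact0 _] hom]; apply/eqP => mj.
have coefm (p f : S) : L f -> (p * f)@_m = p@_0%MM * f@_m.
  move=> /(monomial_idealP monL) Lf.
  rewrite -[p in LHS](subrK (p@_0%MM)%:MP) mulrDl mcoeffD mcoeffCM.
  rewrite -[RHS]add0r; congr (_ + _); apply/eqP; rewrite mcoeff_eq0.
  apply/negP => /msuppM_le /allpairsP [[m1 m2] /= [q1 /Lf L2 e]].
  have e2 : m2 = m by apply: minm; rewrite // e lem_addl.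
  have e1 : m1 = 0%MM by move: e; rewrite e2 -{1}[m]add0m => /addIm.
  by move: q1; rewrite e1 mcoeff_msupp mcoeffB mcoeffC eqxx mulr1 subrr eqxx.
have coef_aug (v : 'rV[S]_(rk F 0)) :
    ((v *m aug F) 0 0)@_m = \sum_k (v 0 k)@_0%MM * (aug F k 0)@_m.
  rewrite mxE raddf_sum /=; apply: eq_bigr => k _; apply: coefm.
  apply/augE; exists (delta_mx 0 k); rewrite -rowE.
  by apply/matrixP => x y; rewrite !ord1 !mxE eqxx.
have [v vE] := (augE 'X_[m]).1 Lm.
pose v0 : 'rV[K]_(rk F 0) := \row_k if shift k == j then (v 0 k)@_0%MM else 0.
have [||w _ wE] := hom v0; rewrite //.
  by move=> k nk; rewrite mxE (negbTE nk).
pose u := map_mx (@mpolyC n K) w *m diff F 0.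
have uE k : (u 0 k)@_0%MM = v0 0 k.
  rewrite wE !mxE raddf_sum /=; apply: eq_bigr => l _.
  by rewrite !mxE mcoeffCM.
have : u *m aug F = 0 by apply/exact0; exists (map_mx (@mpolyC n K) w).
have e k : (u 0 k)@_0%MM * (aug F k 0)@_m = (v 0 k)@_0%MM * (aug F k 0)@_m.
  rewrite uE mxE; case: eqP => // nk.
  rewrite (dhomog_nemf_coeff (aug_homog k)) ?mulr0 //=.
  by rewrite mj; apply/eqP => e; apply: nk.
move/matrixP/(_ 0 0)/(congr1 (mcoeff m)); rewrite coef_aug (eq_bigr _ (fun k _ => e k)).
rewrite -coef_aug vE !mxE mulr1n mcoeffX eqxx mcoeff0 => /eqP.
by rewrite oner_eq0.
Qed.

Lemma linear_resolution_single_degree :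
  monomial_ideal L -> linear_resolution L -> single_degree L.
Proof.
move=> monL [d Tor0] u v.
have deg m : mingen L m -> mdeg m = d.
  move=> mL; apply/eqP/negPn/negP => nd.
  have Tor_m : Tor_eq0 L 0 (mdeg m) by apply: Tor0; rewrite add0n.
  by have := Tor0_mingen_degree monL mL Tor_m; rewrite eqxx.
by move=> /deg -> /deg ->.
Qed.

End LinearResolution.

(** * The equivalence *)

Lemma matroidal_linear_quotients (K : fieldType) (n : nat)
    (L : {mpoly K[n]} -> Prop) :
  matroidal L -> single_degree L /\ revlex_linear_quotients L.
Proof.
move=> mL; have [sqL [_ sdL _]] := mL; split=> //.
have LU := squarefree_given_by sqL; have upU := upset_family_of (proj1 sqL).
have [eqU exU] := (matroidalP upU LU).1 mL.
exact: (matroid_revlex_linear_quotients LU eqU exU).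
Qed.

Theorem corollary1p2 (K : fieldType) (n : nat) (I : {mpoly K[n]} -> Prop)
    (hI : squarefree_monomial_ideal I) :
  [<-> matroidal I;
       forall C : {set 'I_n}, matroidal (monloc I C);
       forall C : {set 'I_n},
         single_degree (monloc I C) /\ revlex_linear_quotients (monloc I C);
       forall C : {set 'I_n}, linear_resolution (monloc I C);
       forall C : {set 'I_n}, single_degree (monloc I C)].
Proof.
have monC C : monomial_ideal (monloc I C).
  have upU := upset_family_of (proj1 hI).
  have CU := given_by_monloc upU (squarefree_given_by hI) C.
  by case: (given_by_squarefree (upset_link upU) CU).
tfae.
- by move=> mI C; apply: matroidal_monloc.
- by move=> mC C; apply: matroidal_linear_quotients.
- move=> lqC C; have [sdC [s _ lqs]] := lqC C.
  exact: linear_quotients_linear_resolution lqs.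
- by move=> lrC C; apply: linear_resolution_single_degree.
exact: matroidal_of_single_degree.
Qed.
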